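(* Consider the family of differential systems in $\mathbb{R}^3$ $$\dot{x}=a(y-x)+yz,\qquad \dot{y}=bx+cy-xz,\qquad \dot{z}=-dz+xy+1,$$ with real parameters $(a,b,c,d)$, $d\neq0$, and its singular point $E_1=\left(0,0,\tfrac1d\right)$. There exist values of the parameters $(a,b,c,d)$ for which the system has at least three limit cycles bifurcating from the singular point $E_1$ under the center conditions $a=b=c=0$, $d\neq 0$. That is, there is $d_0\neq0$ such that for every neighborhood $V$ of $(0,0,0,d_0)$ in the parameter space $\mathbb{R}^4$ and every neighborhood $U$ of $\left(0,0,\tfrac1{d_0}\right)$ in $\mathbb{R}^3$ there is $(a,b,c,d)\in V$ for which the system has at least three limit cycles contained in $U$.
   Context: A limit cycle is an isolated periodic orbit (isolated on the center manifold among the periodic orbits surrounding the singular point). When $a=b=c=0$ and $d\neq0$, the point $E_1$ is a Hopf point (its linearization has a pair of nonzero purely imaginary eigenvalues and one nonzero real eigenvalue) and a center on the center manifold, i.e. all orbits near $E_1$ on a local center manifold, other than $E_1$, are periodic; these are the ''center conditions''. Limit cycles bifurcating from this center are limit cycles appearing in arbitrarily small neighborhoods of it under arbitrarily small variations of the parameters $(a,b,c,d)$. *)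

(* Defs.v *)
(* Stdlib reals with Coquelicot. *)
From Stdlib Require Import Reals.
From Coquelicot Require Import Coquelicot.
Open Scope R_scope.

Definition point : Type := (R * R * R)%type.
Definition params : Type := (R * R * R * R)%type.

Definition field (p : params) (q : point) : point :=
  let '(a, b, c, d) := p in
  let '(x, y, z) := q in
  (a * (y - x) + y * z, b * x + c * y - x * z, - d * z + x * y + 1).

Definition sing_point (d : R) : point := (0, 0, 1 / d).

Definition solution (p : params) (u : R -> point) : Prop :=
  forall t : R, is_derive u t (field p (u t)).

(* [T] is any positive period, not necessarily the least one. *)
Definition periodic_solution (p : params) (T : R) (u : R -> point) : Prop :=
  solution p u /\ 0 < T /\ (forall t : R, u (t + T) = u t) /\
  exists t : R, u t <> u 0.

(* A center manifold at [sing_point d] is tangent to the plane z = 1/d, so it is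
   a graph over a neighbourhood of (0,0) in the (x,y)-plane, with [sing_point d]
   lying over (0,0).  A closed orbit on it surrounds [sing_point d] iff its
   (x,y)-projection has nonzero winding number around (0,0); [theta] is a
   continuous choice of the polar angle along the orbit. *)
Definition winds_around_sing_point (T : R) (u : R -> point) : Prop :=
  exists rho theta : R -> R,
    (forall t : R,
       0 < rho t /\ continuous theta t /\
       fst (fst (u t)) = rho t * cos (theta t) /\
       snd (fst (u t)) = rho t * sin (theta t)) /\
    theta T <> theta 0.

Definition same_set (A B : point -> Prop) : Prop := forall q : point, A q <-> B q.

Definition contained_in (A B : point -> Prop) : Prop := forall q : point, A q -> B q.

Definition periodic_orbit_around (p : params) (gamma : point -> Prop) : Prop :=
  exists (T : R) (u : R -> point),
    periodic_solution p T u /\ winds_around_sing_point T u /\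
    same_set gamma (fun q => exists t : R, q = u t).

(* Isolation is required in R^3, not only inside a center manifold: [gamma] is
   the only periodic orbit surrounding the singular point that is contained in
   the neighbourhood [N].  This implies isolation within any surface containing
   [gamma], in particular within any center manifold. *)
Definition limit_cycle (p : params) (gamma : point -> Prop) : Prop :=
  periodic_orbit_around p gamma /\
  exists N : point -> Prop,
    open N /\ contained_in gamma N /\
    forall gamma' : point -> Prop,
      periodic_orbit_around p gamma' -> contained_in gamma' N ->
      same_set gamma' gamma.

(* Main.v *)
Require Import Defs.
From Stdlib Require Import Reals ZArith Lra Lia Psatz ClassicalEpsilon.
From Coquelicot Require Import Coquelicot.
Open Scope R_scope.

(** Take d0 = sqrt 2.  When a = b = c = 0, the function x^2 + y^2 is a first
    integral, so E_1 is a center.  Put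
      E = (sqrt 2 / 4) (x^2 + y^2),  phi = pi/4 - 2 theta,
      v = sqrt 2 z - 1 - E cos phi,
    with theta the polar angle of (x,y), and let time run so that t = T / sqrt 2.
    If a, b, c are expressed by the three numbers k, s, A through
      a = (s - k)/2 - A/sqrt 2,  c = (s - k)/2 + A/sqrt 2,
      b = - (k + 3 s)/2 + A/sqrt 2,
    and m = A - sqrt 2 s, the system becomes
      phi' = 1 + v + (E + k) cos phi + s sin phi - m,
      E' = E (A + k sin phi - s cos phi),
      v' = - v + E sin phi (v + E cos phi) + E (s - m sin phi - A cos phi).
    The choice d0 = sqrt 2 is what makes the constant detuning m small compared
    with k.  If A, s, m and v are replaced by 0 in the equations for phi and E, the
    function E + k ln (1 + E cos phi) is a first integral.  Corrections to it by polynomials of orders 4 and 5 turn it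
    into an approximate first integral whose derivative is
      E (A + s E / 2 + k^2 E^2 / 4 + 7 k E^3 / 80)
    up to terms of order 6, where E and k have order 1, v has order 2, s has
    order 3 and A has order 4.  With a small parameter l, the scaling E = l x,
    v = l^2 V (V is written v from here on), k = - (21/10) l, s = sigma l^3,
    A = alpha l^4 makes the bracket proportional to (x - 1)(x - 2)(x - 3): three
    simple roots, hence three limit cycles, which shrink to E_1 as l tends to 0.

    Closed orbits are found as profiles: pairs (x, v) of 2 pi-periodic functions
    of the angle phi.
    - Existence ([profile_exists]).  The equations with an unknown constant p
      subtracted from x' are solved by a contraction for every initial value x0
      ([drifting_solution_exists]); p depends continuously on x0
      ([drift_lipschitz]).  As the approximate first integral returns to its
      value after a period, p has the sign of the averaged function near x0
      ([drift_sign]), so that p vanishes somewhere near each simple root.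
    - Isolation ([profile_unique]).  Two profiles near the same root have a common
      period, possibly a large multiple of 2 pi.  At a maximum of the absolute
      difference of v, respectively of the approximate first integral, the
      derivative of that difference vanishes.  This bounds the difference of v
      by that of x, and that of x by a fraction of itself.  The estimate does not
      depend on the period, so it excludes orbits that close up only after many
      turns.
    - Profiles and closed orbits correspond to each other ([profile_orbit] and
      [orbit_profile]).

    All smallness statements are uniform: the functions involved are polynomials
    and quotients that are bounded and Lipschitz on a fixed box, uniformly in
    small l ([tame]), so that the constants in the remainders need not be computed. *)

(** * Functions bounded and Lipschitz on a box, uniformly in the small parameter *)

(** The points (cos phi, sin phi, x, v) of interest; x stays near 1, 2 or 3, and
    the bound on v leaves room around 49/4, the bound of x^2 sin phi cos phi. *)
Definition box (c s x v : R) : Prop :=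
  Rabs c <= 1 /\ Rabs s <= 1 /\ 1/2 <= x <= 7/2 /\ Rabs v <= 20.

Definition gap (c s x v c' s' x' v' : R) : R :=
  Rabs (c - c') + Rabs (s - s') + Rabs (x - x') + Rabs (v - v').

Definition tame_at (K l : R) (G : R -> R -> R -> R -> R -> R) : Prop :=
  forall c s x v c' s' x' v' : R, box c s x v -> box c' s' x' v' ->
    Rabs (G l c s x v) <= K /\
    Rabs (G l c s x v - G l c' s' x' v') <= K * gap c s x v c' s' x' v'.

(** The cosine and the sine of the angle are separate arguments, so that the
    right-hand sides are polynomials or simple quotients.  Lipschitz continuity in
    these two arguments yields continuity of the composition with a path. *)
Definition tame (G : R -> R -> R -> R -> R -> R) : Prop :=
  exists K : R, 0 < K /\ at_right 0 (fun l => tame_at K l G).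

Lemma small_lt e : 0 < e -> at_right 0 (fun l => 0 < l < e).
Proof.
  intros He. exists (mkposreal e He). intros y Hy Hy0.
  unfold ball in Hy; simpl in Hy; unfold AbsRing_ball, abs, minus, plus, opp in Hy; simpl in Hy.
  apply Rabs_lt_between in Hy. lra.
Qed.

Lemma gap_ge0 c s x v c' s' x' v' : 0 <= gap c s x v c' s' x' v'.
Proof.
  unfold gap.
  assert (H := Rabs_pos (c - c')); assert (H0 := Rabs_pos (s - s'));
  assert (H1 := Rabs_pos (x - x')); assert (H2 := Rabs_pos (v - v')); lra.
Qed.

Lemma tame_const a : tame (fun _ _ _ _ _ => a).
Proof.
  exists (Rabs a + 1). split. { assert (H := Rabs_pos a); lra. }
  apply filter_forall. intros l c s x v c' s' x' v' _ _. split. { lra. }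
  rewrite Rminus_diag, Rabs_R0. apply Rmult_le_pos. 2: apply gap_ge0.
  assert (H := Rabs_pos a); lra.
Qed.

Lemma tame_small : tame (fun l _ _ _ _ => l).
Proof.
  exists 1. split. { lra. }
  apply (filter_imp (fun l => 0 < l < 1)). 2: { apply small_lt; lra. }
  intros l Hl c s x v c' s' x' v' _ _. split. { rewrite Rabs_right; lra. }
  rewrite Rminus_diag, Rabs_R0. assert (H := gap_ge0 c s x v c' s' x' v'). lra.
Qed.

Ltac tame_coordinate K :=
  exists K; split; [lra | apply filter_forall];
  intros l c s x v c' s' x' v' (Hc & Hs & Hx & Hv) _; unfold gap;
  assert (H := Rabs_pos (c - c')); assert (H0 := Rabs_pos (s - s'));
  assert (H1 := Rabs_pos (x - x')); assert (H2 := Rabs_pos (v - v'));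
  split; try lra; rewrite Rabs_right; lra.

Lemma tame_c : tame (fun _ c _ _ _ => c). Proof. tame_coordinate 1. Qed.
Lemma tame_s : tame (fun _ _ s _ _ => s). Proof. tame_coordinate 1. Qed.
Lemma tame_x : tame (fun _ _ _ x _ => x). Proof. tame_coordinate 4. Qed.
Lemma tame_v : tame (fun _ _ _ _ v => v). Proof. tame_coordinate 20. Qed.

Lemma tame_opp F : tame F -> tame (fun l c s x v => - F l c s x v).
Proof.
  intros (K & HK & H). exists K. split; [exact HK|]. revert H. apply filter_imp.
  intros l H c s x v c' s' x' v' B B'. destruct (H c s x v c' s' x' v' B B') as [H1 H2].
  rewrite Rabs_Ropp. split; [exact H1|].
  replace (- F l c s x v - - F l c' s' x' v') with (- (F l c s x v - F l c' s' x' v')) by ring.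
  now rewrite Rabs_Ropp.
Qed.

Lemma tame_plus F G : tame F -> tame G -> tame (fun l c s x v => F l c s x v + G l c s x v).
Proof.
  intros (K & HK & H) (L & HL & H'). exists (K + L). split; [lra|].
  generalize (filter_and _ _ H H'). apply filter_imp.
  intros l [HF HG] c s x v c' s' x' v' B B'.
  destruct (HF c s x v c' s' x' v' B B') as [F1 F2]; destruct (HG c s x v c' s' x' v' B B') as [G1 G2].
  split. { apply Rle_trans with (1 := Rabs_triang _ _). lra. }
  replace (F l c s x v + G l c s x v - (F l c' s' x' v' + G l c' s' x' v'))
    with ((F l c s x v - F l c' s' x' v') + (G l c s x v - G l c' s' x' v')) by ring.
  apply Rle_trans with (1 := Rabs_triang _ _). lra.
Qed.

Lemma tame_minus F G : tame F -> tame G -> tame (fun l c s x v => F l c s x v - G l c s x v).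
Proof. intros HF HG. apply (tame_plus F). exact HF. now apply tame_opp. Qed.

Lemma tame_mult F G : tame F -> tame G -> tame (fun l c s x v => F l c s x v * G l c s x v).
Proof.
  intros (K & HK & H) (L & HL & H'). exists (2 * (K * L)). split; [nra|].
  generalize (filter_and _ _ H H'). apply filter_imp.
  intros l [HF HG] c s x v c' s' x' v' B B'.
  destruct (HF c s x v c' s' x' v' B B') as [F1 F2]; destruct (HG c s x v c' s' x' v' B B') as [G1 G2].
  destruct (HG c' s' x' v' c s x v B' B) as [G3 _].
  split.
  - rewrite Rabs_mult. assert (Rabs (F l c s x v) * Rabs (G l c s x v) <= K * L).
    { apply Rmult_le_compat; auto using Rabs_pos. } nra.
  - replace (F l c s x v * G l c s x v - F l c' s' x' v' * G l c' s' x' v')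
      with (F l c s x v * (G l c s x v - G l c' s' x' v') + (F l c s x v - F l c' s' x' v') * G l c' s' x' v') by ring.
    apply Rle_trans with (1 := Rabs_triang _ _). rewrite !Rabs_mult.
    set (D := gap c s x v c' s' x' v') in *.
    assert (Rabs (F l c s x v) * Rabs (G l c s x v - G l c' s' x' v') <= K * (L * D))
      by (apply Rmult_le_compat; auto using Rabs_pos).
    assert (Rabs (F l c s x v - F l c' s' x' v') * Rabs (G l c' s' x' v') <= (K * D) * L)
      by (apply Rmult_le_compat; auto using Rabs_pos).
    lra.
Qed.

Lemma tame_pow F n : tame F -> tame (fun l c s x v => F l c s x v ^ n).
Proof.
  intros HF. induction n as [|n IH]. { exact (tame_const 1). }
  exact (tame_mult _ _ HF IH).
Qed.

Lemma tame_ext F G : (forall l c s x v, F l c s x v = G l c s x v) -> tame F -> tame G.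
Proof.
  intros E (K & HK & H). exists K. split; [exact HK|]. revert H. apply filter_imp.
  intros l H c s x v c' s' x' v'. rewrite <- !E. apply H.
Qed.

Lemma tame_small_mult F : tame F -> forall e, 0 < e ->
  at_right 0 (fun l => 0 < l < 1 /\ forall c s x v, box c s x v -> Rabs (l * F l c s x v) <= e).
Proof.
  intros (K & HK & H) e He.
  assert (P : 0 < Rmin 1 (e / K)). { apply Rmin_pos. lra. now apply Rdiv_lt_0_compat. }
  generalize (filter_and _ _ H (small_lt _ P)). apply filter_imp.
  intros l [HF [Hl0 Hl]]. assert (A1 := Rmin_l 1 (e / K)). assert (A2 := Rmin_r 1 (e / K)).
  split. { lra. } intros c s x v B.
  destruct (HF c s x v c s x v B B) as [F1 _].
  rewrite Rabs_mult, (Rabs_right l) by lra.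
  apply Rle_trans with (e / K * K).
  - apply Rmult_le_compat; try lra. apply Rabs_pos.
  - right. field. lra.
Qed.

(** As l F is at most 1/2 for small l, the denominator stays away from 0. *)
Lemma tame_inv F : tame F -> tame (fun l c s x v => / (1 + l * F l c s x v)).
Proof.
  intros HF. assert (HS := tame_small_mult F HF (1/2) ltac:(lra)).
  destruct HF as (K & HK & H). exists (4 * K + 2). split. { lra. }
  generalize (filter_and _ _ H HS). apply filter_imp.
  intros l [HF [Hl HB]] c s x v c' s' x' v' B B'.
  assert (Y := HB _ _ _ _ B). assert (Y' := HB _ _ _ _ B').
  apply Rabs_le_between in Y. apply Rabs_le_between in Y'.
  destruct (HF c s x v c' s' x' v' B B') as [_ F2].
  set (D := gap c s x v c' s' x' v') in *. assert (HD : 0 <= D) by apply gap_ge0.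
  set (a := F l c s x v) in *. set (b := F l c' s' x' v') in *.
  assert (I : forall t, -(1/2) <= l * t <= 1/2 -> 0 < / (1 + l * t) <= 2).
  { intros t Ht. split. apply Rinv_0_lt_compat; lra.
    replace 2 with (/ (1/2)) by field. apply Rinv_le_contravar; lra. }
  assert (Ia := I a Y). assert (Ib := I b Y').
  split. { rewrite Rabs_right; lra. }
  replace (/ (1 + l * a) - / (1 + l * b)) with (/ (1 + l * a) * / (1 + l * b) * (l * (b - a))) by (field; lra).
  rewrite !Rabs_mult, (Rabs_minus_sym b a), !(Rabs_right (/ _)), (Rabs_right l) by lra.
  assert (/ (1 + l * a) * / (1 + l * b) <= 2 * 2) by (apply Rmult_le_compat; lra).
  assert (l * Rabs (a - b) <= 1 * (K * D)). { apply Rmult_le_compat; try lra. apply Rabs_pos. }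
  apply Rle_trans with (2 * 2 * (1 * (K * D))).
  - apply Rmult_le_compat; auto. apply Rmult_le_pos; lra.
    apply Rmult_le_pos; try lra. apply Rabs_pos.
  - nra.
Qed.

Lemma ln_diff_le a b : 1/2 <= a -> 1/2 <= b -> Rabs (ln a - ln b) <= 2 * Rabs (a - b).
Proof.
  intros Ha Hb.
  destruct (MVT_gen ln b a Rinv) as (z & Hz & E).
  - intros x Hx. apply is_derive_Reals, derivable_pt_lim_ln.
    assert (1/2 <= Rmin b a) by (apply Rmin_glb; lra). lra.
  - intros x Hx. apply derivable_continuous_pt. exists (/ x). apply derivable_pt_lim_ln.
    assert (1/2 <= Rmin b a) by (apply Rmin_glb; lra). lra.
  - rewrite E, Rabs_mult. apply Rmult_le_compat_r. apply Rabs_pos.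
    assert (1/2 <= Rmin b a) by (apply Rmin_glb; lra).
    assert (0 < / z) by (apply Rinv_0_lt_compat; lra).
    rewrite Rabs_right by lra.
    replace 2 with (/ (1/2)) by field. apply Rinv_le_contravar; lra.
Qed.

(** The division by l is harmless: ln (1 + l F) is l times a bounded Lipschitz
    function. *)
Lemma tame_ln F : tame F -> tame (fun l c s x v => ln (1 + l * F l c s x v) / l).
Proof.
  intros HF. assert (HS := tame_small_mult F HF (1/2) ltac:(lra)).
  destruct HF as (K & HK & H). exists (2 * K). split. { lra. }
  generalize (filter_and _ _ H HS). apply filter_imp.
  intros l [HF [Hl HB]] c s x v c' s' x' v' B B'.
  assert (Y := HB _ _ _ _ B). assert (Y' := HB _ _ _ _ B').
  apply Rabs_le_between in Y. apply Rabs_le_between in Y'.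
  destruct (HF c s x v c' s' x' v' B B') as [F1 F2].
  set (D := gap c s x v c' s' x' v') in *.
  set (a := F l c s x v) in *. set (b := F l c' s' x' v') in *.
  assert (Q : forall t, Rabs (t / l) = Rabs t / l).
  { intros t. unfold Rdiv. rewrite Rabs_mult, (Rabs_right (/ l)). auto.
    left. now apply Rinv_0_lt_compat. }
  assert (J : forall p q k, Rabs (p - q) <= k ->
     -(1/2) <= l * p <= 1/2 -> -(1/2) <= l * q <= 1/2 ->
     Rabs ((ln (1 + l * p) - ln (1 + l * q)) / l) <= 2 * k).
  { intros p q k Hk Hp Hq. rewrite Q. apply Rle_div_l. lra.
    apply Rle_trans with (2 * Rabs ((1 + l * p) - (1 + l * q))). apply ln_diff_le; lra.
    replace ((1 + l * p) - (1 + l * q)) with (l * (p - q)) by ring.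
    rewrite Rabs_mult, (Rabs_right l) by lra. nra. }
  split.
  - replace (ln (1 + l * a) / l) with ((ln (1 + l * a) - ln (1 + l * 0)) / l).
    2:{ rewrite Rmult_0_r, Rplus_0_r, ln_1. f_equal. ring. }
    apply J; try lra. now rewrite Rminus_0_r.
  - replace (ln (1 + l * a) / l - ln (1 + l * b) / l) with ((ln (1 + l * a) - ln (1 + l * b)) / l) by (field; lra).
    replace (2 * K * D) with (2 * (K * D)) by ring. apply J; lra.
Qed.

Ltac tame_tac := repeat first
  [ apply tame_small | apply tame_c | apply tame_s | apply tame_x | apply tame_v | apply tame_const
  | assumption | apply tame_inv | apply tame_plus | apply tame_minus
  | apply tame_opp | apply tame_mult | apply tame_pow ].

(** * Periodic functions and the equations X' = f - p and V' = - V + f *)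

Definition periodic (L : R) (f : R -> R) : Prop := forall t : R, f (t + L) = f t.

Lemma periodic_INR L f n t : periodic L f -> f (t + INR n * L) = f t.
Proof.
  intros H. induction n as [|n IH].
  - simpl. f_equal. ring.
  - rewrite S_INR, <- IH, <- (H (t + INR n * L)). f_equal. ring.
Qed.

Lemma periodic_IZR L f n t : periodic L f -> f (t + IZR n * L) = f t.
Proof.
  intros H. destruct (Z_le_dec 0 n) as [Hn|Hn].
  - rewrite <- (Z2Nat.id n Hn), <- INR_IZR_INZ. now apply periodic_INR.
  - replace n with (- Z.of_nat (Z.to_nat (- n)))%Z by lia.
    rewrite opp_IZR, <- INR_IZR_INZ, <- (periodic_INR L f (Z.to_nat (- n)) _ H).
    f_equal. ring.
Qed.

Lemma periodic_reduce L t : 0 < L ->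
  exists t', 0 <= t' <= L /\ forall f, periodic L f -> f t = f t'.
Proof.
  intros HL. exists (t - IZR (Int_part (t / L)) * L). split.
  - destruct (base_Int_part (t / L)) as [A B].
    set (n := IZR (Int_part (t / L))) in *. assert (E : t = t / L * L) by (field; lra).
    assert (n * L <= t / L * L) by (apply Rmult_le_compat_r; lra).
    assert ((t / L - 1) * L < n * L) by (apply Rmult_lt_compat_r; lra).
    lra.
  - intros f Hf. rewrite <- (periodic_IZR L f (- Int_part (t / L)) t Hf), opp_IZR. f_equal. ring.
Qed.

Lemma is_derive_continuous (f : R -> R) (t l : R) : is_derive f t l -> continuous f t.
Proof. intros H. apply (@ex_derive_continuous R_AbsRing R_NormedModule f t). now exists l. Qed.

Lemma periodic_abs_max L f : 0 < L -> periodic L f -> (forall t, continuous f t) ->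
  exists tm, forall t, Rabs (f t) <= Rabs (f tm).
Proof.
  intros HL Hp Hc.
  destruct (continuity_ab_maj (fun t => Rabs (f t)) 0 L) as (tm & Hm & _). { lra. }
  - intros c _. apply continuity_pt_filterlim. apply (continuous_comp f Rabs).
    apply Hc. apply continuous_Rabs.
  - exists tm. intros t. destruct (periodic_reduce L t HL) as (t' & Ht' & E).
    rewrite (E f Hp). now apply Hm.
Qed.

(** Fermat's rule on the whole line. *)
Lemma max_derive0 (f : R -> R) tm l :
  is_derive f tm l -> (forall t, f t <= f tm) -> l = 0.
Proof.
  intros Hd Hm. apply is_derive_Reals in Hd.
  assert (pr : derivable_pt f tm) by (exists l; exact Hd).
  rewrite <- (derive_pt_eq_0 f tm l pr Hd).
  apply (deriv_maximum f (tm - 1) (tm + 1)); auto; lra.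
Qed.

Lemma abs_max_derive0 (f : R -> R) tm l :
  is_derive f tm l -> (forall t, Rabs (f t) <= Rabs (f tm)) -> l = 0.
Proof.
  intros Hd Hm. destruct (Rle_dec 0 (f tm)) as [H|H].
  - apply (max_derive0 f tm); auto. intros t. specialize (Hm t).
    rewrite (Rabs_right (f tm)) in Hm by lra. apply Rabs_le_between in Hm. lra.
  - assert (- l = 0). 2: lra.
    apply (max_derive0 (fun t => - f t) tm).
    + apply (is_derive_opp f tm l Hd).
    + intros t. specialize (Hm t).
      rewrite (Rabs_left (f tm)) in Hm by lra. apply Rabs_le_between in Hm. lra.
Qed.

(** Maximum principle: V' = 0 where the absolute value of V is largest, and there
    V = q.  It gives a bound independent of the period L. *)
Lemma damped_bound L V q B : 0 < L -> periodic L V ->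
  (forall t, is_derive V t (- V t + q t)) -> (forall t, Rabs (q t) <= B) ->
  forall t, Rabs (V t) <= B.
Proof.
  intros HL Hp Hd Hq.
  destruct (periodic_abs_max L V HL Hp) as [tm Hm].
  { intros t. apply (is_derive_continuous _ _ _ (Hd t)). }
  assert (E := abs_max_derive0 _ _ _ (Hd tm) Hm).
  intros t. apply Rle_trans with (1 := Hm t). replace (V tm) with (q tm) by lra. apply Hq.
Qed.

Lemma derive_bound (f df : R -> R) a b B :
  (forall t, is_derive f t (df t)) -> (forall t, Rabs (df t) <= B) ->
  Rabs (f b - f a) <= B * Rabs (b - a).
Proof.
  intros Hd Hb. destruct (MVT_gen f a b df) as (z & _ & E).
  - intros; apply Hd.
  - intros t _. apply continuity_pt_filterlim, (is_derive_continuous _ _ _ (Hd t)).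
  - rewrite E, Rabs_mult. apply Rmult_le_compat_r; auto using Rabs_pos.
Qed.

Lemma periodic_rolle L (f df : R -> R) : 0 < L -> periodic L f ->
  (forall t, is_derive f t (df t)) -> exists t, df t = 0.
Proof.
  intros HL Hp Hd. destruct (MVT_gen f 0 L df) as (z & _ & E).
  - intros; apply Hd.
  - intros t _. apply continuity_pt_filterlim, (is_derive_continuous _ _ _ (Hd t)).
  - exists z. rewrite <- (Rplus_0_l L), Hp, Rminus_diag, Rplus_0_l in E.
    symmetry in E. apply Rmult_integral in E. lra.
Qed.

Lemma zero_derive_const (f : R -> R) : (forall t, is_derive f t 0) -> forall a b, f a = f b.
Proof.
  intros Hd a b. assert (H := derive_bound f (fun _ => 0) b a 0 Hd).
  rewrite Rmult_0_l in H. apply Rminus_diag_uniq.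
  assert (H' : Rabs (f a - f b) <= 0) by (apply H; intros; rewrite Rabs_R0; lra).
  apply Rabs_le_between in H'. lra.
Qed.

(** The constant p is a value of h, because X' vanishes somewhere. *)
Lemma drift_bound L X h p B : 0 < L -> periodic L X ->
  (forall t, is_derive X t (h t - p)) -> (forall t, Rabs (h t) <= B) ->
  Rabs p <= B /\ forall t, Rabs (X t - X 0) <= 2 * B * L.
Proof.
  intros HL Hp Hd Hh.
  assert (Hpb : Rabs p <= B).
  { destruct (periodic_rolle L X _ HL Hp Hd) as [z Hz]. replace p with (h z) by lra. apply Hh. }
  split; [exact Hpb|]. intros t.
  destruct (periodic_reduce L t HL) as (t' & Ht' & E). rewrite (E X Hp).
  assert (HB : 0 <= B) by (apply Rle_trans with (2 := Hpb), Rabs_pos).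
  apply Rle_trans with (2 * B * Rabs (t' - 0)).
  - apply (derive_bound X _ 0 t' (2 * B) Hd). intros u.
    apply Rle_trans with (1 := Rabs_triang _ _). rewrite Rabs_Ropp. specialize (Hh u). lra.
  - rewrite Rabs_right by lra. apply Rmult_le_compat_l; lra.
Qed.

Definition mean (f : R -> R) : R := RInt f 0 (2 * PI) / (2 * PI).

(** Solution operator for X' = f - p, X(0) = x0; the constant p must be the mean of
    f for the solution to be periodic. *)
Definition drift (x0 : R) (f : R -> R) (t : R) : R := x0 + RInt f 0 t - mean f * t.

(** The only 2 pi-periodic solution of V' = - V + f. *)
Definition damp (f : R -> R) (t : R) : R :=
  exp (- t) * (RInt (fun s => exp s * f s) 0 (2 * PI) / (exp (2 * PI) - 1)
               + RInt (fun s => exp s * f s) 0 t).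

Lemma PI2_pos : 0 < 2 * PI. Proof. assert (H := PI_RGT_0). lra. Qed.

Lemma is_derive_primitive (f : R -> R) t : (forall u, continuous f u) ->
  is_derive (fun t => RInt f 0 t) t (f t).
Proof.
  intros Hc. apply (is_derive_RInt f _ 0).
  - apply filter_forall. intros u. apply @RInt_correct, ex_RInt_continuous. auto.
  - auto.
Qed.

Lemma drift_derive x0 f t : (forall u, continuous f u) ->
  is_derive (drift x0 f) t (f t - mean f).
Proof.
  intros Hc. unfold drift.
  apply (is_derive_minus (fun t => x0 + RInt f 0 t) (fun t => mean f * t)).
  - rewrite <- (Rplus_0_l (f t)).
    apply (is_derive_plus (fun _ => x0) (fun t => RInt f 0 t)).
    apply @is_derive_const. now apply is_derive_primitive.
  - auto_derive; auto. ring.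
Qed.

Lemma drift_0 x0 f : drift x0 f 0 = x0.
Proof. unfold drift. rewrite RInt_point. unfold zero; simpl. ring. Qed.

Lemma is_derive_shift (f : R -> R) L t l : is_derive f (t + L) l ->
  is_derive (fun u => f (u + L)) t l.
Proof.
  intros H. replace l with (scal 1 l) by (unfold scal; simpl; unfold mult; simpl; ring).
  apply (is_derive_comp f (fun u => u + L)). exact H.
  auto_derive; auto.
Qed.

Lemma drift_periodic x0 f : (forall u, continuous f u) -> periodic (2 * PI) f ->
  periodic (2 * PI) (drift x0 f).
Proof.
  intros Hc Hp t. apply Rminus_diag_uniq.
  rewrite (zero_derive_const (fun t => drift x0 f (t + 2 * PI) - drift x0 f t)) with (b := 0).
  - rewrite Rplus_0_l, drift_0. unfold drift, mean. field. apply Rgt_not_eq, PI_RGT_0.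
  - intros u. replace 0 with ((f (u + 2 * PI) - mean f) - (f u - mean f)) by (rewrite Hp; ring).
    apply (is_derive_minus (fun t => drift x0 f (t + 2 * PI)) (drift x0 f)).
    + now apply is_derive_shift, drift_derive.
    + now apply drift_derive.
Qed.

Lemma exp_mult_continuous f : (forall u, continuous f u) -> forall u, continuous (fun s => exp s * f s) u.
Proof. intros Hc u. apply (continuous_mult exp f); auto. apply continuous_exp. Qed.

Lemma damp_derive f t : (forall u, continuous f u) ->
  is_derive (damp f) t (- damp f t + f t).
Proof.
  intros Hc. unfold damp.
  set (C := RInt _ 0 (2 * PI) / _).
  replace (- _ + f t) with
    ((- exp (- t)) * (C + RInt (fun s => exp s * f s) 0 t) + exp (- t) * (exp t * f t)).
  - apply (is_derive_mult (fun t => exp (- t)) (fun t => C + RInt (fun s => exp s * f s) 0 t)).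
    + auto_derive; auto. ring.
    + rewrite <- (Rplus_0_l (exp t * f t)).
      apply (is_derive_plus (fun _ => C) (fun t => RInt (fun s => exp s * f s) 0 t)).
      apply @is_derive_const. apply (is_derive_primitive (fun s => exp s * f s)).
      now apply exp_mult_continuous.
    + intros; apply Rmult_comm.
  - rewrite <- (Rmult_assoc (exp (- t)) (exp t)), <- exp_plus.
    rewrite Rplus_opp_l, exp_0. ring.
Qed.

Lemma damp_periodic f : (forall u, continuous f u) -> periodic (2 * PI) f ->
  periodic (2 * PI) (damp f).
Proof.
  intros Hc Hp t. apply Rminus_diag_uniq.
  apply (Rmult_eq_reg_l (exp t)). 2: apply Rgt_not_eq, exp_pos.
  rewrite Rmult_0_r.
  rewrite (zero_derive_const (fun t => exp t * (damp f (t + 2 * PI) - damp f t))) with (b := 0).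
  - rewrite exp_0, Rplus_0_l, Rmult_1_l. unfold damp.
    rewrite RInt_point, Ropp_0, exp_0, exp_Ropp. unfold zero; simpl.
    assert (1 < exp (2 * PI)). { rewrite <- exp_0. apply exp_increasing, PI2_pos. }
    field. lra.
  - intros u.
    replace 0 with (exp u * (damp f (u + 2 * PI) - damp f u) +
       exp u * ((- damp f (u + 2 * PI) + f (u + 2 * PI)) - (- damp f u + f u))) by (rewrite (Hp u); ring).
    apply (is_derive_mult exp (fun t => damp f (t + 2 * PI) - damp f t)).
    + apply is_derive_Reals, derivable_pt_lim_exp.
    + apply (is_derive_minus (fun t => damp f (t + 2 * PI)) (damp f)).
      * apply (is_derive_shift (damp f)). now apply damp_derive.
      * now apply damp_derive.
    + intros; apply Rmult_comm.
Qed.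

(** * Periodic solutions up to a constant drift *)

Lemma geometric_zero a M : (forall n, Rabs a <= M * (1/2) ^ n) -> a = 0.
Proof.
  intros H. assert (HM : 0 <= M). { specialize (H O). simpl in H. assert (P := Rabs_pos a). lra. }
  destruct (Req_dec a 0) as [E|E]; auto. exfalso. apply Rabs_pos_lt in E.
  assert (P : 0 < Rabs a / (M + 1)) by (apply Rdiv_lt_0_compat; lra).
  destruct (pow_lt_1_zero (1/2)) with (y := Rabs a / (M + 1)) as [N HN]; auto.
  { rewrite Rabs_right; lra. }
  specialize (HN N (le_n N)). specialize (H N).
  rewrite Rabs_right in HN by (apply Rle_ge, pow_le; lra).
  assert (M * (1/2) ^ N <= M * (Rabs a / (M + 1))) by (apply Rmult_le_compat_l; lra).
  assert (M * (Rabs a / (M + 1)) < Rabs a).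
  { apply (Rmult_lt_reg_r (M + 1)). lra.
    replace (M * (Rabs a / (M + 1)) * (M + 1)) with (M * Rabs a) by (field; lra). nra. }
  lra.
Qed.

(** Uniform convergence at a geometric rate, stated with an explicit error so that
    continuity, periodicity and the fixed point equation all pass to the limit. *)
Lemma geometric_limit (u : nat -> R -> R) M :
  (forall n t, Rabs (u (S n) t - u n t) <= M * (1/2) ^ n) ->
  exists U, forall n t, Rabs (u n t - U t) <= 2 * M * (1/2) ^ n.
Proof.
  intros H.
  assert (HM : 0 <= M). { specialize (H O 0). simpl in H.
    apply Rle_trans with (2 := eq_ind _ (fun z => _ <= z) H _ (Rmult_1_r M)). apply Rabs_pos. }
  assert (B : forall t n k, Rabs (u (n + k)%nat t - u n t) <= 2 * M * (1/2) ^ n - 2 * M * (1/2) ^ (n + k)).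
  { intros t n k. induction k as [|k IH].
    - rewrite Nat.add_0_r, Rminus_diag, Rminus_diag, Rabs_R0. lra.
    - rewrite Nat.add_succ_r.
      replace (u (S (n + k)) t - u n t) with ((u (S (n + k)) t - u (n + k)%nat t) + (u (n + k)%nat t - u n t)) by ring.
      apply Rle_trans with (1 := Rabs_triang _ _). specialize (H (n + k)%nat t). simpl. lra. }
  assert (P : forall n, 0 <= M * (1/2) ^ n) by (intros; apply Rmult_le_pos; auto; apply pow_le; lra).
  assert (B' : forall t n m, (n <= m)%nat -> Rabs (u m t - u n t) <= 2 * M * (1/2) ^ n).
  { intros t n m Hm. replace m with (n + (m - n))%nat by lia.
    specialize (B t n (m - n)%nat). specialize (P (n + (m - n))%nat). lra. }
  assert (C : forall t, ex_finite_lim_seq (fun n => u n t)).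
  { intros t. apply ex_lim_seq_cauchy_corr. intros eps.
    assert (P0 : 0 < eps / (4 * M + 1)) by (apply Rdiv_lt_0_compat; [apply cond_pos | lra]).
    destruct (pow_lt_1_zero (1/2)) with (y := eps / (4 * M + 1)) as [N HN]; auto.
    { rewrite Rabs_right; lra. }
    exists N. intros n m Hn Hm.
    assert (A1 := B' t N n Hn). assert (A2 := B' t N m Hm).
    specialize (HN N (le_n N)). rewrite Rabs_right in HN by (apply Rle_ge, pow_le; lra).
    replace (u n t - u m t) with ((u n t - u N t) - (u m t - u N t)) by ring.
    apply Rle_lt_trans with (4 * M * (1/2) ^ N).
    - apply Rle_trans with (1 := Rabs_triang _ _). rewrite Rabs_Ropp. lra.
    - apply Rle_lt_trans with (4 * M * (eps / (4 * M + 1))). nra.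
      apply (Rmult_lt_reg_r (4 * M + 1)). lra. assert (E := cond_pos eps).
      replace (4 * M * (eps / (4 * M + 1)) * (4 * M + 1)) with (4 * M * eps) by (field; lra). nra. }
  exists (fun t => real (Lim_seq (fun n => u n t))). intros n t.
  assert (L := Lim_seq_correct' _ (C t)).
  assert (LL : is_lim_seq (fun k => Rabs (u n t - u (k + n)%nat t)) (Rabs (u n t - real (Lim_seq (fun n => u n t))))).
  { apply (is_lim_seq_abs (fun k => u n t - u (k + n)%nat t) (u n t - real (Lim_seq (fun n => u n t)))).
    apply is_lim_seq_minus'. apply is_lim_seq_const.
    now apply (is_lim_seq_incr_n (fun k => u k t)). }
  apply (is_lim_seq_le _ (fun _ => 2 * M * (1/2) ^ n) _ _) with (2 := LL) (3 := is_lim_seq_const _).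
  intros k. rewrite Rabs_minus_sym. apply B'. lia.
Qed.

Lemma uniform_limit_continuous (u : nat -> R -> R) U M :
  (forall n t, continuous (u n) t) ->
  (forall n t, Rabs (u n t - U t) <= M * (1/2) ^ n) -> forall t, continuous U t.
Proof.
  intros Hc H t. apply filterlim_locally. intros eps.
  assert (HM : 0 <= M). { specialize (H O t). simpl in H. assert (P := Rabs_pos (u O t - U t)). lra. }
  assert (P0 : 0 < eps / (4 * M + 4)) by (apply Rdiv_lt_0_compat; [apply cond_pos | lra]).
  destruct (pow_lt_1_zero (1/2)) with (y := eps / (4 * M + 4)) as [N HN]; auto.
  { rewrite Rabs_right; lra. }
  specialize (HN N (le_n N)). rewrite Rabs_right in HN by (apply Rle_ge, pow_le; lra).
  assert (E0 : M * (1/2) ^ N < eps / 4).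
  { apply Rle_lt_trans with (M * (eps / (4 * M + 4))). nra.
    apply (Rmult_lt_reg_r (4 * M + 4)). lra. assert (E := cond_pos eps).
    replace (M * (eps / (4 * M + 4)) * (4 * M + 4)) with (M * eps) by (field; lra). nra. }
  assert (HE : 0 < eps / 4). { assert (E := cond_pos eps). lra. }
  assert (F := proj1 (filterlim_locally (u N) (u N t)) (Hc N t) (mkposreal _ HE)).
  revert F. apply filter_imp. intros s Hs.
  change (Rabs (u N s - u N t) < eps / 4) in Hs. change (Rabs (U s - U t) < eps).
  assert (A1 := H N s). assert (A2 := H N t).
  replace (U s - U t) with (- (u N s - U s) + ((u N s - u N t) + (u N t - U t))) by ring.
  assert (T1 := Rabs_triang (- (u N s - U s)) ((u N s - u N t) + (u N t - U t))).
  assert (T2 := Rabs_triang (u N s - u N t) (u N t - U t)).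
  rewrite Rabs_Ropp in T1. lra.
Qed.

(** The two properties of a right-hand side that the solution operators need. *)
Definition coefficient (P : R -> R -> R -> R) : Prop :=
  (forall X V, (forall t, continuous X t) -> (forall t, continuous V t) ->
     forall t, continuous (fun s => P s (X s) (V s)) t) /\
  forall t x v, P (t + 2 * PI) x v = P t x v.

(** The fast right-hand side may depend strongly on x, with constant K; the slow one
    must have a Lipschitz constant that is small compared with 1 / K. *)
Definition slow_fast (eta K : R) (P Q : R -> R -> R -> R) : Prop :=
  coefficient P /\ coefficient Q /\ 0 <= eta /\ 0 <= K /\
  8 * PI * eta * (1 + 4 * K) <= 1/2 /\
  (forall t x v x' v', Rabs (P t x v - P t x' v') <= eta * (Rabs (x - x') + Rabs (v - v'))) /\
  (forall t x v x' v', Rabs (Q t x v - Q t x' v') <= K * Rabs (x - x') + Rabs (v - v') / 4).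

(** The drift p measures by how much the solution of the original equations, with
    p = 0, fails to close up. *)
Definition drifting_solution (P Q : R -> R -> R -> R) (x0 p : R) (X V : R -> R) : Prop :=
  periodic (2 * PI) X /\ periodic (2 * PI) V /\ X 0 = x0 /\
  (forall t, is_derive X t (P t (X t) (V t) - p)) /\
  (forall t, is_derive V t (- V t + Q t (X t) (V t))).

(** One step of the iteration.  The difference of the V-components obeys the maximum
    principle; that of the X-components is a drift over one period. *)
Lemma drift_step P Q eta K x0 X V X' V' a b :
  slow_fast eta K P Q ->
  (forall t, continuous X t) -> (forall t, continuous V t) ->
  (forall t, continuous X' t) -> (forall t, continuous V' t) ->
  periodic (2 * PI) X -> periodic (2 * PI) V -> periodic (2 * PI) X' -> periodic (2 * PI) V' ->
  (forall t, Rabs (X t - X' t) <= a) -> (forall t, Rabs (V t - V' t) <= b) ->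
  forall t,
  Rabs (drift x0 (fun s => P s (X s) (V s)) t - drift x0 (fun s => P s (X' s) (V' s)) t) <= 4 * PI * eta * (a + b) /\
  Rabs (damp (fun s => Q s (X s) (V s)) t - damp (fun s => Q s (X' s) (V' s)) t) <= K * a + b / 4.
Proof.
  intros ((cP & pP) & (cQ & pQ) & He & HK & _ & LP & LQ) cX cV cX' cV' pX pV pX' pV' Ha Hb.
  assert (per : forall G Y W, (forall t x v, G (t + 2 * PI) x v = G t x v) ->
     periodic (2 * PI) Y -> periodic (2 * PI) W -> periodic (2 * PI) (fun s : R => G s (Y s) (W s) : R)).
  { intros R0 Y W H H1 H2 s. now rewrite H, H1, H2. }
  intros t. split.
  - set (f := fun s => P s (X s) (V s)). set (g := fun s => P s (X' s) (V' s)).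
    assert (D : forall t, is_derive (fun t => drift x0 f t - drift x0 g t) t ((f t - g t) - (mean f - mean g))).
    { intros s. replace (f s - g s - (mean f - mean g)) with ((f s - mean f) - (g s - mean g)) by ring.
      apply (is_derive_minus (drift x0 f) (drift x0 g)); apply drift_derive; unfold f, g; auto. }
    destruct (drift_bound (2 * PI) (fun t => drift x0 f t - drift x0 g t) (fun t => f t - g t)
      (mean f - mean g) (eta * (a + b)) PI2_pos) as [_ E].
    + assert (pf : periodic (2 * PI) (drift x0 f)) by (apply drift_periodic; unfold f; auto).
      assert (pg : periodic (2 * PI) (drift x0 g)) by (apply drift_periodic; unfold g; auto).
      intros s. now rewrite pf, pg.
    + exact D.
    + intros s. apply Rle_trans with (1 := LP s _ _ _ _). apply Rmult_le_compat_l; auto.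
      specialize (Ha s); specialize (Hb s); lra.
    + specialize (E t). rewrite !drift_0, Rminus_diag, Rminus_0_r in E. lra.
  - set (f := fun s => Q s (X s) (V s)). set (g := fun s => Q s (X' s) (V' s)).
    apply (damped_bound (2 * PI) (fun t => damp f t - damp g t) (fun t => f t - g t)).
    + apply PI2_pos.
    + assert (pf : periodic (2 * PI) (damp f)) by (apply damp_periodic; unfold f; auto).
      assert (pg : periodic (2 * PI) (damp g)) by (apply damp_periodic; unfold g; auto).
      intros s. now rewrite pf, pg.
    + intros s. replace (- (damp f s - damp g s) + (f s - g s)) with ((- damp f s + f s) - (- damp g s + g s)) by ring.
      apply (is_derive_minus (damp f) (damp g)); apply damp_derive; unfold f, g; auto.
    + intros s. apply Rle_trans with (1 := LQ s _ _ _ _).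
      assert (K * Rabs (X s - X' s) <= K * a) by (apply Rmult_le_compat_l; auto).
      specialize (Hb s). lra.
Qed.

(** Contraction for the iteration that applies both solution operators. *)
Lemma drifting_solution_exists P Q eta K x0 : slow_fast eta K P Q ->
  exists p X V, drifting_solution P Q x0 p X V.
Proof.
  intros HS.
  pose (step := fun w : (R -> R) * (R -> R) =>
     (drift x0 (fun s => P s (fst w s) (snd w s)), damp (fun s => Q s (fst w s) (snd w s)))).
  pose (w := fix w n := match n with O => (fun _ : R => x0, fun _ : R => 0) | S n => step (w n) end).
  assert (HS' := HS). destruct HS' as ((cP & pP) & (cQ & pQ) & He & HK & Hsm & _).
  assert (good : forall n, (forall t, continuous (fst (w n)) t) /\ (forall t, continuous (snd (w n)) t) /\
     periodic (2 * PI) (fst (w n)) /\ periodic (2 * PI) (snd (w n))).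
  { induction n as [|n (c1 & c2 & p1 & p2)].
    - simpl. repeat split; intros; apply continuous_const.
    - simpl. repeat split.
      + intros t. apply (is_derive_continuous _ _ _ (drift_derive x0 _ t (cP _ _ c1 c2))).
      + intros t. apply (is_derive_continuous _ _ _ (damp_derive _ t (cQ _ _ c1 c2))).
      + apply drift_periodic; auto. intros t. now rewrite pP, p1, p2.
      + apply damp_periodic; auto. intros t. now rewrite pQ, p1, p2. }
  destruct (periodic_abs_max (2 * PI) (fun t => fst (w 1%nat) t - fst (w 0%nat) t)) as [t1 H1].
  { apply PI2_pos. }
  { intros t. destruct (good 0%nat) as (_ & _ & p0 & _), (good 1%nat) as (_ & _ & p1 & _). now rewrite p0, p1. }
  { intros t. apply (continuous_minus (fst (w 1%nat)) (fst (w 0%nat)));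
    [apply (proj1 (good 1%nat)) | apply (proj1 (good 0%nat))]. }
  destruct (periodic_abs_max (2 * PI) (fun t => snd (w 1%nat) t - snd (w 0%nat) t)) as [t2 H2].
  { apply PI2_pos. }
  { intros t. destruct (good 0%nat) as (_ & _ & _ & p0), (good 1%nat) as (_ & _ & _ & p1). now rewrite p0, p1. }
  { intros t. apply (continuous_minus (snd (w 1%nat)) (snd (w 0%nat)));
    [apply (proj1 (proj2 (good 1%nat))) | apply (proj1 (proj2 (good 0%nat)))]. }
  set (M1 := Rabs (fst (w 1%nat) t1 - fst (w 0%nat) t1)) in H1.
  set (M2 := Rabs (snd (w 1%nat) t2 - snd (w 0%nat) t2)) in H2.
  set (M := M1 + M2).
  assert (HM1 : 0 <= M1) by apply Rabs_pos. assert (HM2 : 0 <= M2) by apply Rabs_pos.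
  assert (Hpi := PI_RGT_0).
  (* The weight 1 + 4 K for V absorbs the constant K of the fast equation. *)
  assert (contr : forall n t, Rabs (fst (w (S n)) t - fst (w n) t) <= M * (1/2) ^ n /\
     Rabs (snd (w (S n)) t - snd (w n) t) <= (1 + 4 * K) * M * (1/2) ^ n).
  { induction n as [|n IH]; intros t.
    - specialize (H1 t). specialize (H2 t). rewrite pow_O, !Rmult_1_r.
      assert (0 <= K * M) by (apply Rmult_le_pos; unfold M; lra).
      split; unfold M in *; nra.
    - destruct (good n) as (? & ? & ? & ?), (good (S n)) as (? & ? & ? & ?).
      destruct (drift_step P Q eta K x0 (fst (w (S n))) (snd (w (S n))) (fst (w n)) (snd (w n))
        (M * (1/2) ^ n) ((1 + 4 * K) * M * (1/2) ^ n) HS) with (t := t) as [E1 E2]; auto.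
      { intros; apply IH. } { intros; apply IH. }
      assert (Hm0 : 0 <= M * (1/2) ^ n) by (apply Rmult_le_pos; [unfold M; lra | apply pow_le; lra]).
      set (m := M * (1/2) ^ n) in *.
      replace ((1 + 4 * K) * M * (1/2) ^ n) with ((1 + 4 * K) * m) in * by (unfold m; ring).
      split.
      + apply Rle_trans with (1 := E1). simpl.
        replace (M * (1/2 * (1/2) ^ n)) with (1/2 * m) by (unfold m; ring).
        assert (U1 : 0 <= PI * (eta * (K * m))).
        { apply Rmult_le_pos; [lra | apply Rmult_le_pos; [auto | apply Rmult_le_pos; auto]]. }
        assert (U2 : 8 * PI * eta * (1 + 4 * K) * m <= 1/2 * m) by (apply Rmult_le_compat_r; auto).
        clear -U1 U2. lra.
      + apply Rle_trans with (1 := E2). simpl.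
        replace ((1 + 4 * K) * M * (1/2 * (1/2) ^ n)) with (1/2 * ((1 + 4 * K) * m)) by (unfold m; ring).
        clearbody m. clear -Hm0. lra. }
  destruct (geometric_limit (fun n => fst (w n)) M) as [X HX]. { intros; apply contr. }
  destruct (geometric_limit (fun n => snd (w n)) ((1 + 4 * K) * M)) as [V HV]. { intros; apply contr. }
  assert (cX : forall t, continuous X t).
  { apply (uniform_limit_continuous (fun n => fst (w n)) X (2 * M)); auto. intros n; apply (proj1 (good n)). }
  assert (cV : forall t, continuous V t).
  { apply (uniform_limit_continuous (fun n => snd (w n)) V (2 * ((1 + 4 * K) * M))); auto. intros; apply good. }
  assert (perl : forall u U C, (forall n, periodic (2 * PI) (u n)) ->
     (forall (n : nat) t, Rabs (u n t - U t) <= C * (1/2) ^ n) -> periodic (2 * PI) U).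
  { intros u U C Hu HU t. apply Rminus_diag_uniq, (geometric_zero _ (2 * C)). intros n.
    replace (U (t + 2 * PI) - U t) with (- (u n (t + 2 * PI) - U (t + 2 * PI)) + (u n t - U t))
      by (rewrite (Hu n t); ring).
    apply Rle_trans with (1 := Rabs_triang _ _). rewrite Rabs_Ropp.
    assert (A1 := HU n t). assert (A2 := HU n (t + 2 * PI)). lra. }
  assert (pX : periodic (2 * PI) X).
  { apply (perl (fun n => fst (w n)) X (2 * M)); auto. intros; apply good. }
  assert (pV : periodic (2 * PI) V).
  { apply (perl (fun n => snd (w n)) V (2 * ((1 + 4 * K) * M))); auto. intros; apply good. }
  assert (fix_ : forall t, X t = drift x0 (fun s => P s (X s) (V s)) t /\ V t = damp (fun s => Q s (X s) (V s)) t).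
  { intros t.
    assert (HM : 0 <= M) by (unfold M; lra).
    set (b := 2 * M + 2 * ((1 + 4 * K) * M)).
    assert (step_le : forall n,
      Rabs (fst (w (S n)) t - drift x0 (fun s => P s (X s) (V s)) t) <= 4 * PI * eta * b * (1/2) ^ n /\
      Rabs (snd (w (S n)) t - damp (fun s => Q s (X s) (V s)) t) <= (K * (2 * M) + b) * (1/2) ^ n).
    { intros n. destruct (good n) as (? & ? & ? & ?).
      destruct (drift_step P Q eta K x0 (fst (w n)) (snd (w n)) X V
        (2 * M * (1/2) ^ n) (2 * ((1 + 4 * K) * M) * (1/2) ^ n) HS) with (t := t) as [E1 E2]; auto.
      split.
      - apply Rle_trans with (1 := E1). right. unfold b. ring.
      - apply Rle_trans with (1 := E2).
        assert (0 <= (1/2) ^ n) by (apply pow_le; lra).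
        assert (0 <= 2 * ((1 + 4 * K) * M)) by nra.
        unfold b. nra. }
    split.
    - apply Rminus_diag_uniq, (geometric_zero _ (2 * M + 4 * PI * eta * b)). intros n.
      replace (X t - _) with (- (fst (w (S n)) t - X t) + (fst (w (S n)) t - drift x0 (fun s => P s (X s) (V s)) t)) by ring.
      apply Rle_trans with (1 := Rabs_triang _ _). rewrite Rabs_Ropp.
      assert (A1 := HX (S n) t). destruct (step_le n) as [A2 _]. simpl pow in A1.
      assert (0 <= M * (1/2) ^ n) by (apply Rmult_le_pos; auto; apply pow_le; lra). lra.
    - apply Rminus_diag_uniq, (geometric_zero _ (2 * ((1 + 4 * K) * M) + (K * (2 * M) + b))). intros n.
      replace (V t - _) with (- (snd (w (S n)) t - V t) + (snd (w (S n)) t - damp (fun s => Q s (X s) (V s)) t)) by ring.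
      apply Rle_trans with (1 := Rabs_triang _ _). rewrite Rabs_Ropp.
      assert (A1 := HV (S n) t). destruct (step_le n) as [_ A2]. simpl pow in A1.
      assert (0 <= (1 + 4 * K) * M * (1/2) ^ n).
      { repeat apply Rmult_le_pos; try lra. apply pow_le; lra. } lra. }
  exists (mean (fun s => P s (X s) (V s))), X, V.
  split; [exact pX | split; [exact pV | split; [|split]]].
  - rewrite (proj1 (fix_ 0)). apply drift_0.
  - intros t. apply (is_derive_ext (drift x0 (fun s => P s (X s) (V s)))).
    { intros s. symmetry. apply fix_. }
    apply (drift_derive x0 (fun s => P s (X s) (V s))). auto.
  - intros t. apply (is_derive_ext (damp (fun s => Q s (X s) (V s)))).
    { intros s. symmetry. apply fix_. }
    rewrite (proj2 (fix_ t)) at 1. apply (damp_derive (fun s => Q s (X s) (V s))). auto.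
Qed.

Lemma drift_lipschitz P Q eta K x0 p X V x0' p' X' V' : slow_fast eta K P Q ->
  drifting_solution P Q x0 p X V -> drifting_solution P Q x0' p' X' V' ->
  Rabs (p - p') <= Rabs (x0 - x0').
Proof.
  intros (_ & _ & He & HK & Hsm & LP & LQ) (pX & pV & X0 & dX & dV) (pX' & pV' & X0' & dX' & dV').
  assert (Hpi := PI2_pos).
  assert (dD : forall t, is_derive (fun t => X t - X' t) t ((P t (X t) (V t) - P t (X' t) (V' t)) - (p - p'))).
  { intros t. replace (_ - (p - p')) with ((P t (X t) (V t) - p) - (P t (X' t) (V' t) - p')) by ring.
    now apply (is_derive_minus X X'). }
  assert (dW : forall t, is_derive (fun t => V t - V' t) t
     (- (V t - V' t) + (Q t (X t) (V t) - Q t (X' t) (V' t)))).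
  { intros t. replace (- (V t - V' t) + _) with ((- V t + Q t (X t) (V t)) - (- V' t + Q t (X' t) (V' t))) by ring.
    now apply (is_derive_minus V V'). }
  assert (pD : periodic (2 * PI) (fun t => X t - X' t)) by (intros t; now rewrite pX, pX').
  assert (pW : periodic (2 * PI) (fun t => V t - V' t)) by (intros t; now rewrite pV, pV').
  destruct (periodic_abs_max (2 * PI) _ Hpi pD) as [t1 H1].
  { intros t. apply (is_derive_continuous _ _ _ (dD t)). }
  destruct (periodic_abs_max (2 * PI) _ Hpi pW) as [t2 H2].
  { intros t. apply (is_derive_continuous _ _ _ (dW t)). }
  set (M := Rabs (X t1 - X' t1)) in H1. set (N := Rabs (V t2 - V' t2)) in H2.
  assert (HM : 0 <= M) by apply Rabs_pos. assert (HN : 0 <= N) by apply Rabs_pos.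
  assert (A : N <= K * M + N / 4).
  { apply (damped_bound _ _ (fun t => Q t (X t) (V t) - Q t (X' t) (V' t)) (K * M + N / 4) Hpi pW dW).
    intros t. apply Rle_trans with (1 := LQ t _ _ _ _).
    assert (K * Rabs (X t - X' t) <= K * M) by (apply Rmult_le_compat_l; auto). specialize (H2 t). lra. }
  destruct (drift_bound (2 * PI) (fun t => X t - X' t) (fun t => P t (X t) (V t) - P t (X' t) (V' t))
    (p - p') (eta * (M + N)) Hpi pD dD) as [E1 E2].
  { intros t. apply Rle_trans with (1 := LP t _ _ _ _). apply Rmult_le_compat_l; auto.
    specialize (H1 t). specialize (H2 t). lra. }
  specialize (E2 t1). rewrite X0, X0' in E2.
  assert (T := Rabs_triang (X t1 - X' t1 - (x0 - x0')) (x0 - x0')).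
  replace (X t1 - X' t1 - (x0 - x0') + (x0 - x0')) with (X t1 - X' t1) in T by ring. fold M in T.
  assert (S1 : M + N <= (1 + 4 * K) * M) by nra.
  assert (S2 : eta * (M + N) <= eta * ((1 + 4 * K) * M)) by (apply Rmult_le_compat_l; auto).
  assert (S3 : 8 * PI * (eta * (M + N)) <= 1/2 * M).
  { apply Rle_trans with (8 * PI * (eta * ((1 + 4 * K) * M))).
    apply Rmult_le_compat_l; lra.
    replace (8 * PI * (eta * ((1 + 4 * K) * M))) with (8 * PI * eta * (1 + 4 * K) * M) by ring.
    apply Rmult_le_compat_r; lra. }
  assert (S4 : 0 <= eta * (M + N)) by (apply Rmult_le_pos; lra).
  assert (3 < PI) by (assert (T3 := PI2_3_2); lra).
  nra.
Qed.

(** * The normalized system and its approximate first integral *)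

(** The three constants are determined by the required identity
    x (alpha + sigma x / 2 + kappa^2 x^2 / 4 - 7 kappa x^3 / 80) = averaged x
    with roots 1, 2, 3 on the right: the sum 6 of the roots fixes kappa. *)
Definition kappa := 21/10.
Definition alpha := 441/400.
Definition sigma := - (1617/400).

(** The constant m of the angular equation, divided by l^3. *)
Definition detuning (l : R) := alpha * l - sqrt 2 * sigma.
Definition speed2 (l c s x v : R) := v + l * (sigma * s - detuning l).
Definition speed1 l c s x v := (x - kappa) * c + l * speed2 l c s x v.

(** The angular speed phi', as a tower of its expansion in l; the arguments c and s
    stand for cos phi and sin phi. *)
Definition speed l c s x v := 1 + l * speed1 l c s x v.
Definition growth2 (l c : R) := l * alpha - sigma * c.

(** The derivative of ln x in normalized time, divided by l. *)
Definition growth (l c s : R) := - kappa * s + l ^ 2 * growth2 l c.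
Definition fast_rate2 l c s x := x * (sigma - detuning l * s - l * alpha * c).
Definition fast_rate1 l c s x v := x * s * v + l * fast_rate2 l c s x.

(** The derivative of v in normalized time. *)
Definition fast_rate l c s x v := - v + x ^ 2 * s * c + l * fast_rate1 l c s x v.

(** The leading part of the derivative of the approximate first integral, divided by
    l^4. *)
Definition averaged x := - (147/800) * x * (x - 1) * (x - 2) * (x - 3).

(** The trigonometric polynomials of the corrections.  With c^2 + s^2 = 1 they solve
    tf' - tf = s,  tF' = tf s c,
    tf1' - tf1 = 1/2 - s c,
    tG1' = - s c / 2 + s c (s c + c^2 - s^2) / 5 + (c + s) s c^2 / 2 - 7/80,
    tG2' = (s^2 - s c) / 2 - 1/4,
    where ' is the derivative in phi.  The first and the third remove
    terms that are linear in v, through v' = - v + x^2 s c; the others remove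
    oscillations, and the means 7/80 and 1/4 that they leave are the coefficients
    of the averaged function. *)
Definition tf (c s : R) := - (c + s) / 2.
Definition tF (c s : R) := (c ^ 3 - s ^ 3) / 6.
Definition tf1 (c s : R) := - (1/2) + (s * c + c ^ 2 - s ^ 2) / 5.
Definition tG1 (c s : R) := - s ^ 2 / 4 + s ^ 2 * c ^ 2 / 10 - c ^ 4 / 8 - 7/80 * s * c * (c ^ 2 - s ^ 2).
Definition tG2 (c s : R) := - (s ^ 2 + s * c) / 4.

(** A prime denotes the derivative in phi. *)
Definition tf' (c s : R) := (s - c) / 2.
Definition tF' (c s : R) := tf c s * s * c.
Definition tf1' (c s : R) := (c ^ 2 - s ^ 2 - 4 * s * c) / 5.
Definition tG1' (c s : R) := - s * c / 2 + s * c * (c ^ 2 - s ^ 2) / 5 + c ^ 3 * s / 2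
   - 7/80 * (c ^ 2 - s ^ 2) ^ 2 + 7/20 * s ^ 2 * c ^ 2.
Definition tG2' (c s : R) := - (2 * s * c + c ^ 2 - s ^ 2) / 4.

(** The corrections of relative orders 3 and 4 in l; the suffixes _t, _x, _v denote
    the derivatives in phi, x, v. *)
Definition Psi3 (c s x v : R) := sigma * x * s - kappa * (x * tf c s * v - x ^ 3 * tF c s).
Definition Psi3_t (c s x v : R) := sigma * x * c - kappa * (x * tf' c s * v - x ^ 3 * tF' c s).
Definition Psi3_x (c s x v : R) := sigma * s - kappa * (tf c s * v - 3 * x ^ 2 * tF c s).
Definition Psi3_v (c s x : R) := - kappa * x * tf c s.
Definition Psi4 l (c s x v : R) := - kappa * detuning l * x * c - sigma * x ^ 2 * s * c / 2
  - kappa * (x ^ 2 * tf1 c s * v - x ^ 4 * tG1 c s) - kappa ^ 2 * (x * v / 2 + x ^ 3 * tG2 c s).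
Definition Psi4_t l (c s x v : R) := kappa * detuning l * x * s - sigma * x ^ 2 * (c ^ 2 - s ^ 2) / 2
  - kappa * (x ^ 2 * tf1' c s * v - x ^ 4 * tG1' c s) - kappa ^ 2 * (x ^ 3 * tG2' c s).
Definition Psi4_x l (c s x v : R) := - kappa * detuning l * c - sigma * x * s * c
  - kappa * (2 * x * tf1 c s * v - 4 * x ^ 3 * tG1 c s) - kappa ^ 2 * (v / 2 + 3 * x ^ 2 * tG2 c s).
Definition Psi4_v (c s x : R) := - kappa * x ^ 2 * tf1 c s - kappa ^ 2 * x / 2.

(** The inverse of 1 + E cos phi, from the derivative of the logarithm. *)
Definition recip l c x := / (1 + l * (x * c)).

(** The remainder is collected from the logarithmic part of the first integral and
    from the two corrections; all that matters is that it is tame. *)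
Definition rem_log l c s x v := recip l c x * kappa * x * (x ^ 2 * c ^ 2 * s * v - x * c * (sigma - detuning l * s) - alpha * c).
Definition rem3 l c s x v := Psi3_t c s x v * speed2 l c s x v + Psi3_x c s x v * (x * (l * growth2 l c)) + Psi3_v c s x * fast_rate2 l c s x.
Definition rem4 l c s x v := Psi4_t l c s x v * speed1 l c s x v + Psi4_x l c s x v * (x * growth l c s) + Psi4_v c s x * fast_rate1 l c s x v.
Definition rem_time l c s x v := rem_log l c s x v + rem3 l c s x v + rem4 l c s x v.

(** At order 3 the derivative of the logarithmic part is cancelled exactly. *)
Lemma order3_cancels c s x v : Psi3_t c s x v + Psi3_v c s x * (- v + x ^ 2 * s * c) = sigma * x * c - kappa * x * s * v.
Proof. unfold Psi3_t, Psi3_v, tF', tf', tf. field. Qed.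

Ltac field_modulo H := apply Rminus_diag_uniq; field_simplify; [match goal with |- ?a / _ = 0 =>
  replace a with 0 by ring [H] end; field | .. ].

(** At order 4 all oscillating terms cancel and the averaged function remains. *)
Lemma order4_averages l c s x v : s * s = 1 - c * c ->
  Psi4_t l c s x v + Psi4_v c s x * (- v + x ^ 2 * s * c)
  + Psi3_t c s x v * ((x - kappa) * c) + Psi3_x c s x v * (- kappa * s * x) + Psi3_v c s x * (x * s * v)
  + alpha * x + kappa * x * (sigma - detuning l * s) - kappa * x ^ 2 * s * c * v = averaged x.
Proof.
intros H.
unfold Psi3_t, Psi3_v, Psi3_x, Psi4_t, Psi4_v, tF, tF', tf', tf, tf1, tf1', tG1, tG1', tG2, tG2', averaged, kappa, alpha, sigma.
field_modulo H.
Qed.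

Definition Psi_x l c s x v := 1 - kappa * l * c * recip l c x + l ^ 3 * Psi3_x c s x v + l ^ 4 * Psi4_x l c s x v.

(** The left-hand side is the derivative of the approximate first integral [Psi]
    along the normalized system. *)
Lemma Psi_flow l c s x v : s * s = 1 - c * c -> 1 + l * (x * c) <> 0 ->
  (kappa * l * x * s * recip l c x + l ^ 3 * Psi3_t c s x v + l ^ 4 * Psi4_t l c s x v) * speed l c s x v
  + Psi_x l c s x v * (l * (x * growth l c s))
  + (l ^ 3 * Psi3_v c s x + l ^ 4 * Psi4_v c s x) * fast_rate l c s x v = l ^ 4 * averaged x + l ^ 5 * rem_time l c s x v.
Proof.
intros H H0.
rewrite <- (order4_averages l c s x v H).
assert (H3 := order3_cancels c s x v).
transitivity ((kappa * l * x * s * recip l c x + l ^ 4 * Psi4_t l c s x v) * speed l c s x v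
  + l ^ 3 * Psi3_t c s x v * (l * speed1 l c s x v)
  + Psi_x l c s x v * (l * (x * growth l c s))
  + l ^ 3 * Psi3_v c s x * (l * fast_rate1 l c s x v) + l ^ 4 * Psi4_v c s x * fast_rate l c s x v
  + l ^ 3 * (Psi3_t c s x v + Psi3_v c s x * (- v + x ^ 2 * s * c))).
{ unfold fast_rate, speed; ring. }
rewrite H3.
unfold Psi_x, rem_time, rem_log, rem3, rem4, speed, speed1, speed2, growth, growth2, fast_rate, fast_rate1, fast_rate2, recip.
generalize (Psi3_t c s x v) (Psi3_x c s x v) (Psi3_v c s x) (Psi4_t l c s x v) (Psi4_x l c s x v) (Psi4_v c s x) (detuning l).
intros. field_modulo H; auto; now rewrite Rmult_assoc, Rplus_comm.
Qed.

(** * The equations with the angle as time *)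

(** The equations after division by the angular speed are x' = l slow and
    v' = - v + x^2 sin phi cos phi + l fast. *)
Definition slow l c s x v := x * growth l c s * / speed l c s x v.
Definition fast l c s x v := (fast_rate1 l c s x v - (- v + x ^ 2 * s * c) * speed1 l c s x v) * / speed l c s x v.

(** The first integral E + k ln (1 + E cos phi) in the scaled variables, divided by
    l, with its corrections. *)
Definition Psi l c s x v := x - kappa * ln (1 + l * (x * c)) + l ^ 3 * Psi3 c s x v + l ^ 4 * Psi4 l c s x v.

(** [Psi] is x + l [Psi_tail]: a perturbation of the coordinate x. *)
Definition Psi_tail l c s x v := - kappa * (ln (1 + l * (x * c)) / l) + l ^ 2 * Psi3 c s x v + l ^ 3 * Psi4 l c s x v.

(** The derivative of [Psi] in x is 1 + l [Psi_x1]. *)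
Definition Psi_x1 l c s x v := - kappa * c * recip l c x + l ^ 2 * Psi3_x c s x v + l ^ 3 * Psi4_x l c s x v.
Definition rem_angle l c s x v := (rem_time l c s x v - averaged x * speed1 l c s x v) * / speed l c s x v.

Lemma tame_xc : tame (fun l c s x v => x * c). Proof. tame_tac. Qed.
Lemma tame_speed1 : tame speed1.
Proof. apply (tame_ext (fun l c s x v => (x - kappa) * c + l * (v + l * (sigma * s - (alpha * l - sqrt 2 * sigma))))).
 reflexivity. tame_tac. Qed.
Lemma tame_inv_speed : tame (fun l c s x v => / speed l c s x v).
Proof. exact (tame_inv _ tame_speed1). Qed.
Lemma tame_recip : tame (fun l c s x v => recip l c x).
Proof. exact (tame_inv _ tame_xc). Qed.

Ltac tame_unfold := 
  unfold Psi3, Psi3_t, Psi3_x, Psi3_v, Psi4, Psi4_t, Psi4_x, Psi4_v, tF, tF', tf, tf', tf1, tf1', tG1, tG1', tG2, tG2', averaged, speed2, growth, growth2, fast_rate1, fast_rate2, detuning, Rdiv.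
Ltac tame_all := tame_unfold; repeat first [apply tame_inv_speed | apply tame_recip | apply tame_speed1 | tame_tac].

Lemma tame_slow : tame slow.
Proof. unfold slow. tame_all. Qed.
Lemma tame_fast : tame fast.
Proof. unfold fast. tame_all. Qed.
Lemma tame_Psi_tail : tame Psi_tail.
Proof.
  unfold Psi_tail. apply tame_plus. apply tame_plus. apply tame_mult. tame_tac. apply (tame_ln _ tame_xc).
  all: tame_all.
Qed.
Lemma tame_Psi_x1 : tame Psi_x1. Proof. unfold Psi_x1. tame_all. Qed.
Lemma tame_rem_angle : tame rem_angle. Proof. unfold rem_angle, rem_time, rem_log, rem3, rem4. tame_all. Qed.

Lemma sin_sq t : sin t * sin t = 1 - cos t * cos t.
Proof. assert (H := sin2_cos2 t). unfold Rsqr in H. lra. Qed.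

(** The constant p is 0 for the actual system; other values occur in the search for
    periodic solutions. *)
Definition drifting l p (X V : R -> R) t : Prop :=
  is_derive X t (l * slow l (cos t) (sin t) (X t) (V t) - p) /\
  is_derive V t (- V t + (X t ^ 2 * sin t * cos t + l * fast l (cos t) (sin t) (X t) (V t))).

Lemma Psi_derive l p X V t : drifting l p X V t ->
  0 < 1 + l * (X t * cos t) -> speed l (cos t) (sin t) (X t) (V t) <> 0 ->
  is_derive (fun t => Psi l (cos t) (sin t) (X t) (V t)) t
    (l ^ 4 * averaged (X t) + l ^ 5 * rem_angle l (cos t) (sin t) (X t) (V t)
     - p * (1 + l * Psi_x1 l (cos t) (sin t) (X t) (V t))).
Proof.
  intros [dX dV] Hl Hy.
  assert (E := Psi_flow l (cos t) (sin t) (X t) (V t) (sin_sq t) (Rgt_not_eq _ _ Hl)).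
  assert (D : is_derive (fun t => Psi l (cos t) (sin t) (X t) (V t)) t
    ((kappa * l * X t * sin t * recip l (cos t) (X t) + l ^ 3 * Psi3_t (cos t) (sin t) (X t) (V t) + l ^ 4 * Psi4_t l (cos t) (sin t) (X t) (V t))
     + Psi_x l (cos t) (sin t) (X t) (V t) * (l * slow l (cos t) (sin t) (X t) (V t) - p)
     + (l ^ 3 * Psi3_v (cos t) (sin t) (X t) + l ^ 4 * Psi4_v (cos t) (sin t) (X t)) *
       (- V t + (X t ^ 2 * sin t * cos t + l * fast l (cos t) (sin t) (X t) (V t))))).
  { generalize dependent (l * slow l (cos t) (sin t) (X t) (V t) - p). intros dx dX.
    generalize dependent (- V t + (X t ^ 2 * sin t * cos t + l * fast l (cos t) (sin t) (X t) (V t))). intros dv dV.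
    unfold Psi, Psi3, Psi4, tf, tf1, tF, tG1, tG2.
    auto_derive.
    { repeat split; auto; try (exists dx; exact dX); try (exists dv; exact dV). }
    assert (EX : Derive (fun x : R => X x) t = dx) by exact (is_derive_unique X t dx dX).
    assert (EV : Derive (fun x : R => V x) t = dv) by exact (is_derive_unique V t dv dV).
    rewrite EX, EV.
    unfold Psi_x, Psi3_t, Psi3_x, Psi3_v, Psi4_t, Psi4_x, Psi4_v, tf', tf1', tF', tG1', tG2', tf, tf1, tF, tG1, tG2, recip.
    field. lra. }
  replace (_ - p * _) with
    ((kappa * l * X t * sin t * recip l (cos t) (X t) + l ^ 3 * Psi3_t (cos t) (sin t) (X t) (V t) + l ^ 4 * Psi4_t l (cos t) (sin t) (X t) (V t))
     + Psi_x l (cos t) (sin t) (X t) (V t) * (l * slow l (cos t) (sin t) (X t) (V t) - p)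
     + (l ^ 3 * Psi3_v (cos t) (sin t) (X t) + l ^ 4 * Psi4_v (cos t) (sin t) (X t)) *
       (- V t + (X t ^ 2 * sin t * cos t + l * fast l (cos t) (sin t) (X t) (V t)))).
  exact D.
  replace (1 + l * Psi_x1 l (cos t) (sin t) (X t) (V t)) with (Psi_x l (cos t) (sin t) (X t) (V t)).
  2:{ unfold Psi_x, Psi_x1. ring. }
  set (c := cos t) in *; set (s := sin t) in *; set (x := X t) in *; set (v := V t) in *.
  unfold rem_angle, slow, fast.
  apply (Rmult_eq_reg_r (speed l c s x v)); auto.
  transitivity (l ^ 4 * averaged x + l ^ 5 * rem_time l c s x v - p * Psi_x l c s x v * speed l c s x v).
  - rewrite <- E. unfold fast_rate. 
    assert (Y : speed l c s x v = 1 + l * speed1 l c s x v) by reflexivity.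
    field_simplify; auto. rewrite Y. field.
  - assert (Y : speed l c s x v = 1 + l * speed1 l c s x v) by reflexivity.
    field_simplify; auto. rewrite Y. ring.
Qed.

(** * Uniqueness of profiles near a root *)

Definition root (r : R) : Prop := r = 1 \/ r = 2 \/ r = 3.

Definition inbox (X V : R -> R) : Prop := forall t, 1/2 <= X t <= 7/2 /\ Rabs (V t) <= 20.

Definition profile l (X V : R -> R) : Prop := forall t, drifting l 0 X V t.

Lemma box_trig t x v : 1/2 <= x <= 7/2 -> Rabs v <= 20 -> box (cos t) (sin t) x v.
Proof.
  intros Hx Hv. assert (A := COS_bound t). assert (B := SIN_bound t).
  repeat split; auto; try (apply Rabs_le; lra); lra.
Qed.

(** The consequences of tameness that the estimates use, for one fixed l.  The lower
    bounds make the change of variables, the logarithm and the division by the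
    angular speed legitimate. *)
Definition uniformly_small (e l : R) : Prop :=
  0 < l < 1 /\
  (forall F, F = slow \/ F = fast \/ F = Psi_tail \/ F = rem_angle ->
   forall c s x v c' s' x' v', box c s x v -> box c' s' x' v' ->
     Rabs (l * F l c s x v) <= e /\
     Rabs (l * F l c s x v - l * F l c' s' x' v') <= e * gap c s x v c' s' x' v') /\
  (forall c s x v, box c s x v -> 1/2 <= 1 + l * Psi_x1 l c s x v /\ 1/2 <= speed l c s x v <= 3/2 /\
     1/2 <= 1 + l * (x * c)).

Lemma tame_scaled F e : tame F -> 0 < e -> at_right 0 (fun l => forall c s x v c' s' x' v',
   box c s x v -> box c' s' x' v' ->
     Rabs (l * F l c s x v) <= e /\
     Rabs (l * F l c s x v - l * F l c' s' x' v') <= e * gap c s x v c' s' x' v').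
Proof.
  intros (K & HK & H) He.
  assert (P : 0 < e / K) by now apply Rdiv_lt_0_compat.
  generalize (filter_and _ _ H (small_lt _ P)). apply filter_imp.
  intros l [HF [Hl0 Hl]] c s x v c' s' x' v' B B'.
  destruct (HF c s x v c' s' x' v' B B') as [A1 A2].
  assert (E : l * K <= e). { replace e with (e / K * K) by (field; lra). apply Rmult_le_compat_r; lra. }
  rewrite <- Rmult_minus_distr_l, !Rabs_mult, (Rabs_right l) by lra.
  assert (G := gap_ge0 c s x v c' s' x' v').
  split.
  - apply Rle_trans with (l * K); auto. apply Rmult_le_compat_l; lra.
  - apply Rle_trans with (l * (K * gap c s x v c' s' x' v')).
    apply Rmult_le_compat_l; lra. rewrite <- Rmult_assoc. now apply Rmult_le_compat_r.
Qed.

Lemma uniformly_small_eventually e : 0 < e -> at_right 0 (uniformly_small e).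
Proof.
  intros He.
  assert (A1 := tame_scaled _ e tame_slow He). assert (A2 := tame_scaled _ e tame_fast He).
  assert (A3 := tame_scaled _ e tame_Psi_tail He). assert (A4 := tame_scaled _ e tame_rem_angle He).
  assert (B1 := tame_small_mult _ tame_Psi_x1 (1/2) ltac:(lra)).
  assert (B2 := tame_small_mult _ tame_speed1 (1/2) ltac:(lra)).
  assert (B3 := tame_small_mult _ tame_xc (1/2) ltac:(lra)).
  generalize (filter_and _ _ A1 (filter_and _ _ A2 (filter_and _ _ A3 (filter_and _ _ A4
    (filter_and _ _ B1 (filter_and _ _ B2 B3)))))).
  apply filter_imp. intros l (C1 & C2 & C3 & C4 & D1 & D2 & D3).
  split; [apply D1|]. split.
  - intros F [E|[E|[E|E]]]; rewrite E; auto.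
  - intros c s x v B. destruct D1 as [_ D1], D2 as [_ D2], D3 as [_ D3].
    specialize (D1 _ _ _ _ B). specialize (D2 _ _ _ _ B). specialize (D3 _ _ _ _ B).
    apply Rabs_le_between in D1. apply Rabs_le_between in D2. apply Rabs_le_between in D3.
    unfold speed. lra.
Qed.

Lemma gap_same c s x v x' v' : gap c s x v c s x' v' = Rabs (x - x') + Rabs (v - v').
Proof. unfold gap. rewrite !Rminus_diag, Rabs_R0. ring. Qed.

Definition averaged' x := - (147/800) * (4 * x ^ 3 - 18 * x ^ 2 + 22 * x - 6).

(** The roots are simple: the derivative at r + w is expanded in w. *)
Lemma averaged_slope r x x' : root r -> Rabs (x - r) <= 1/5 -> Rabs (x' - r) <= 1/5 ->
  1/10 * Rabs (x - x') <= Rabs (averaged x - averaged x').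
Proof.
  intros Hr Hx Hx'. apply Rabs_le_between in Hx. apply Rabs_le_between in Hx'.
  destruct (MVT_gen averaged x' x averaged') as (z & Hz & E).
  - intros y _. unfold averaged, averaged'. auto_derive; auto. ring.
  - intros y _. apply continuity_pt_filterlim, (is_derive_continuous averaged y (averaged' y)).
    unfold averaged, averaged'. auto_derive; auto. ring.
  - rewrite E, Rabs_mult. apply Rmult_le_compat_r. apply Rabs_pos.
    assert (Hz' : r - 1/5 <= z <= r + 1/5).
    { revert Hz. unfold Rmin, Rmax. destruct (Rle_dec x' x); lra. }
    clear -Hr Hz'. unfold averaged'.
    set (w := z - r). assert (W1 : -1/5 <= w <= 1/5) by (unfold w; lra).
    assert (W2 : 0 <= w * w <= 1/25) by nra.
    assert (W3 : -1/125 <= w * (w * w) <= 1/125) by nra.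
    replace z with (r + w) by (unfold w; ring). clearbody w.
    destruct Hr as [-> | [-> | ->]].
    + rewrite Rabs_left; lra.
    + rewrite Rabs_right; lra.
    + rewrite Rabs_left; lra.
Qed.

Lemma sq_lipschitz x x' s c : 1/2 <= x <= 7/2 -> 1/2 <= x' <= 7/2 -> Rabs s <= 1 -> Rabs c <= 1 ->
  Rabs (x ^ 2 * s * c - x' ^ 2 * s * c) <= 7 * Rabs (x - x').
Proof.
  intros Hx Hx' Hs Hc. replace (x ^ 2 * s * c - x' ^ 2 * s * c) with ((x + x') * (s * c) * (x - x')) by ring.
  rewrite Rabs_mult. apply Rmult_le_compat_r. apply Rabs_pos.
  rewrite Rabs_mult, (Rabs_right (x + x')), Rabs_mult by lra.
  assert (Rabs s * Rabs c <= 1 * 1) by (apply Rmult_le_compat; auto using Rabs_pos).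
  assert (0 <= Rabs s * Rabs c) by (apply Rmult_le_pos; apply Rabs_pos). nra.
Qed.

Lemma Psi_split l c s x v : l <> 0 -> Psi l c s x v = x + l * Psi_tail l c s x v.
Proof. intros Hl. unfold Psi, Psi_tail. field. auto. Qed.

(** Let M, N be the largest differences of x and v.  The maximum principle for the
    v-equation gives N <= 15 M.  At a maximum of the difference of [Psi] the
    averaged function takes almost equal values on both profiles; as the root is
    simple, the difference of x there is at most M/4, and since [Psi] is close to x
    this forces M <= 3/4 M. *)
Lemma profile_unique l r L X V X' V' : uniformly_small (1/4000) l -> root r -> 0 < L ->
  periodic L cos -> periodic L sin ->
  periodic L X -> periodic L V -> periodic L X' -> periodic L V' ->
  profile l X V -> profile l X' V' -> inbox X V -> inbox X' V' ->
  (forall t, Rabs (X t - r) <= 1/5) -> (forall t, Rabs (X' t - r) <= 1/5) ->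
  forall t, X t = X' t /\ V t = V' t.
Proof.
  intros (Hl & HT & HB) Hr HL pc ps pX pV pX' pV' H H' B B' Hn Hn'.
  assert (bx : forall t, box (cos t) (sin t) (X t) (V t)) by (intros t; apply box_trig; apply B).
  assert (bx' : forall t, box (cos t) (sin t) (X' t) (V' t)) by (intros t; apply box_trig; apply B').
  set (Ps := fun t => Psi l (cos t) (sin t) (X t) (V t)).
  set (Ps' := fun t => Psi l (cos t) (sin t) (X' t) (V' t)).
  assert (dPs : forall t, is_derive (fun t => Ps t - Ps' t) t
     ((l ^ 4 * averaged (X t) + l ^ 5 * rem_angle l (cos t) (sin t) (X t) (V t)) -
      (l ^ 4 * averaged (X' t) + l ^ 5 * rem_angle l (cos t) (sin t) (X' t) (V' t)))).
  { intros t.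
    assert (E := Psi_derive l 0 X V t (H t)). assert (E' := Psi_derive l 0 X' V' t (H' t)).
    rewrite Rmult_0_l, Rminus_0_r in E, E'.
    destruct (HB _ _ _ _ (bx t)) as (_ & Y1 & Z1). destruct (HB _ _ _ _ (bx' t)) as (_ & Y2 & Z2).
    apply (is_derive_minus Ps Ps'); [apply E | apply E']; lra. }
  set (q := fun t => (X t ^ 2 * sin t * cos t + l * fast l (cos t) (sin t) (X t) (V t)) -
     (X' t ^ 2 * sin t * cos t + l * fast l (cos t) (sin t) (X' t) (V' t))).
  assert (dW : forall t, is_derive (fun t => V t - V' t) t (- (V t - V' t) + q t)).
  { intros t. destruct (H t) as [_ D], (H' t) as [_ D'].
    replace (- (V t - V' t) + q t) with
      ((- V t + (X t ^ 2 * sin t * cos t + l * fast l (cos t) (sin t) (X t) (V t))) -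
       (- V' t + (X' t ^ 2 * sin t * cos t + l * fast l (cos t) (sin t) (X' t) (V' t))))
      by (unfold q; ring).
    now apply (is_derive_minus V V'). }
  destruct (periodic_abs_max L (fun t => X t - X' t) HL) as [t1 H1].
  { intros t. now rewrite pX, pX'. }
  { intros t. apply (continuous_minus X X').
    apply (is_derive_continuous X t _ (proj1 (H t))). apply (is_derive_continuous X' t _ (proj1 (H' t))). }
  destruct (periodic_abs_max L (fun t => V t - V' t) HL) as [t2 H2].
  { intros t. now rewrite pV, pV'. }
  { intros t. apply (is_derive_continuous (fun t => V t - V' t) t _ (dW t)). }
  destruct (periodic_abs_max L (fun t => Ps t - Ps' t) HL) as [t3 H3].
  { intros t. unfold Ps, Ps'. now rewrite pc, ps, pX, pV, pX', pV'. }
  { intros t. apply (is_derive_continuous (fun t => Ps t - Ps' t) t _ (dPs t)). }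
  set (M := Rabs (X t1 - X' t1)) in H1. set (N := Rabs (V t2 - V' t2)) in H2.
  assert (HM : 0 <= M) by apply Rabs_pos. assert (HN : 0 <= N) by apply Rabs_pos.
  assert (G : forall F, F = slow \/ F = fast \/ F = Psi_tail \/ F = rem_angle -> forall t,
    Rabs (l * F l (cos t) (sin t) (X t) (V t) - l * F l (cos t) (sin t) (X' t) (V' t)) <= 1/4000 * (M + N)).
  { intros F HF t. destruct (HT F HF _ _ _ _ _ _ _ _ (bx t) (bx' t)) as [_ E].
    rewrite gap_same in E. specialize (H1 t). specialize (H2 t). lra. }
  assert (EN : N <= 15 * M).
  { assert (N <= 7 * M + 1/4000 * (M + N)); [|lra].
    apply (damped_bound L (fun t => V t - V' t) q _ HL). { intros t. now rewrite pV, pV'. } exact dW.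
    intros t. unfold q.
    replace (_ - (X' t ^ 2 * sin t * cos t + _)) with ((X t ^ 2 * sin t * cos t - X' t ^ 2 * sin t * cos t) +
      (l * fast l (cos t) (sin t) (X t) (V t) - l * fast l (cos t) (sin t) (X' t) (V' t))) by ring.
    apply Rle_trans with (1 := Rabs_triang _ _). apply Rplus_le_compat.
    - apply Rle_trans with (7 * Rabs (X t - X' t)).
      + destruct (bx t) as (? & ? & ? & ?). apply sq_lipschitz; auto. apply (proj1 (B' t)).
      + specialize (H1 t). lra.
    - apply G. auto. }
  assert (EP : forall t, Rabs ((Ps t - Ps' t) - (X t - X' t)) <= M / 4).
  { intros t. unfold Ps, Ps'. rewrite !Psi_split by lra.
    replace (_ - (X t - X' t)) with (l * Psi_tail l (cos t) (sin t) (X t) (V t) - l * Psi_tail l (cos t) (sin t) (X' t) (V' t)) by ring.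
    apply Rle_trans with (1 := G Psi_tail ltac:(auto) t). lra. }
  (* dividing the vanishing derivative of the difference by l^4 *)
  assert (E3 := abs_max_derive0 (fun t => Ps t - Ps' t) t3 _ (dPs t3) H3).
  assert (E4 : averaged (X t3) - averaged (X' t3) = - (l * rem_angle l (cos t3) (sin t3) (X t3) (V t3) - l * rem_angle l (cos t3) (sin t3) (X' t3) (V' t3))).
  { apply (Rmult_eq_reg_l (l ^ 4)). 2: apply pow_nonzero; lra. simpl in *. lra. }
  assert (E5 := averaged_slope r _ _ Hr (Hn t3) (Hn' t3)).
  assert (E6 := G rem_angle ltac:(auto) t3). rewrite E4, Rabs_Ropp in E5.
  assert (Psi3 := EP t3). assert (P1 := EP t1). specialize (H3 t1).
  assert (T3 := Rabs_triang ((Ps t3 - Ps' t3) - (X t3 - X' t3)) (X t3 - X' t3)).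
  replace (Ps t3 - Ps' t3 - (X t3 - X' t3) + (X t3 - X' t3)) with (Ps t3 - Ps' t3) in T3 by ring.
  assert (T1 := Rabs_triang (- ((Ps t1 - Ps' t1) - (X t1 - X' t1))) (Ps t1 - Ps' t1)).
  replace (- (Ps t1 - Ps' t1 - (X t1 - X' t1)) + (Ps t1 - Ps' t1)) with (X t1 - X' t1) in T1 by ring.
  rewrite Rabs_Ropp in T1. fold M in T1.
  assert (M0 : M = 0) by lra.
  intros t. specialize (H1 t). specialize (H2 t).
  split; apply Rminus_diag_uniq, Rabs_eq_0; apply Rle_antisym; try apply Rabs_pos; lra.
Qed.

(** * Existence of profiles near a root *)

Definition clamp (a b x : R) : R := Rmax a (Rmin b x).

Lemma clamp_in a b x : a <= b -> a <= clamp a b x <= b.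
Proof.
  intros H. unfold clamp, Rmax, Rmin. 
  destruct (Rle_dec b x); repeat (match goal with |- context [Rle_dec ?u ?v] => destruct (Rle_dec u v) end); lra.
Qed.

Lemma clamp_id a b x : a <= x <= b -> clamp a b x = x.
Proof. intros H. unfold clamp. rewrite Rmin_right, Rmax_right; lra. Qed.

Lemma clamp_lipschitz a b x x' : a <= b -> Rabs (clamp a b x - clamp a b x') <= Rabs (x - x').
Proof.
  intros H. unfold clamp, Rmax, Rmin.
  destruct (Rle_dec b x), (Rle_dec b x');
  repeat (match goal with |- context [Rle_dec ?u ?v] => destruct (Rle_dec u v) end);
  unfold Rabs; repeat (match goal with |- context [Rcase_abs ?u] => destruct (Rcase_abs u) end); lra.
Qed.

(** Truncation of the arguments makes the equations globally Lipschitz; the solutions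
    of interest stay where it has no effect. *)
Definition clamped (F : R -> R -> R -> R -> R) t x v := F (cos t) (sin t) (clamp (1/2) (7/2) x) (clamp (-20) 20 v).

Lemma clamped_box t x v : box (cos t) (sin t) (clamp (1/2) (7/2) x) (clamp (-20) 20 v).
Proof.
  apply box_trig. apply clamp_in; lra. apply Rabs_le. apply clamp_in; lra.
Qed.

Lemma clamped_coefficient F K : 0 < K ->
  (forall c s x v c' s' x' v', box c s x v -> box c' s' x' v' ->
     Rabs (F c s x v - F c' s' x' v') <= K * gap c s x v c' s' x' v') ->
  coefficient (clamped F).
Proof.
  intros HK HF. split.
  - intros X V cX cV t. apply filterlim_locally. intros eps.
    assert (HE : 0 < eps / (4 * K)) by (apply Rdiv_lt_0_compat; [apply cond_pos | lra]).
    assert (near : forall f : R -> R, continuous f t -> locally t (fun u => Rabs (f u - f t) < eps / (4 * K))).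
    { intros f Hf. exact (proj1 (filterlim_locally f (f t)) Hf (mkposreal _ HE)). }
    generalize (filter_and _ _ (near cos (continuous_cos t)) (filter_and _ _ (near sin (continuous_sin t))
      (filter_and _ _ (near X (cX t)) (near V (cV t))))).
    apply filter_imp. intros u (A1 & A2 & A3 & A4).
    change (Rabs (clamped F u (X u) (V u) - clamped F t (X t) (V t)) < eps).
    apply Rle_lt_trans with (1 := HF _ _ _ _ _ _ _ _ (clamped_box u (X u) (V u)) (clamped_box t (X t) (V t))).
    assert (B1 := clamp_lipschitz (1/2) (7/2) (X u) (X t) ltac:(lra)).
    assert (B2 := clamp_lipschitz (-20) 20 (V u) (V t) ltac:(lra)).
    replace (pos eps) with (K * (4 * (eps / (4 * K)))) by (field; lra).
    apply Rmult_lt_compat_l; auto. unfold gap. lra.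
  - intros t x v. unfold clamped. now rewrite cos_plus, sin_plus, cos_2PI, sin_2PI, !Rmult_1_r, !Rmult_0_r, Rminus_0_r, Rplus_0_r.
Qed.

Definition clamped_slow l := clamped (fun c s x v => l * slow l c s x v).
Definition clamped_fast l := clamped (fun c s x v => x ^ 2 * s * c + l * fast l c s x v).

Lemma clamped_slow_fast l : uniformly_small (1/4000) l -> slow_fast (1/4000) 8 (clamped_slow l) (clamped_fast l).
Proof.
  intros (Hl & HT & HB).
  assert (HS := HT slow ltac:(auto)). assert (HF := HT fast ltac:(auto)).
  assert (SQ : forall c s x v c' s' x' v', box c s x v -> box c' s' x' v' ->
     Rabs (x ^ 2 * s * c - x' ^ 2 * s' * c') <= 13 * gap c s x v c' s' x' v').
  { intros c s x v c' s' x' v' (B1 & B2 & B3 & B4) (B1' & B2' & B3' & B4').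
    assert (E1 := sq_lipschitz x x' s c B3 B3' B2 B1).
    replace (x ^ 2 * s * c - x' ^ 2 * s' * c') with
      ((x ^ 2 * s * c - x' ^ 2 * s * c) + x' ^ 2 * ((s - s') * c + s' * (c - c'))) by ring.
    apply Rle_trans with (1 := Rabs_triang _ _).
    assert (E2 : Rabs (x' ^ 2 * ((s - s') * c + s' * (c - c'))) <= 13 * (Rabs (s - s') + Rabs (c - c'))).
    { rewrite Rabs_mult. apply Rmult_le_compat; auto using Rabs_pos.
      - rewrite Rabs_right; nra.
      - apply Rle_trans with (1 := Rabs_triang _ _). rewrite !Rabs_mult.
        assert (U1 := Rabs_pos (s - s')). assert (U2 := Rabs_pos (c - c')).
        assert (U3 := Rabs_pos c). assert (U4 := Rabs_pos s'). nra. }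
    assert (U1 := Rabs_pos (x - x')). assert (U2 := Rabs_pos (v - v')). unfold gap. lra. }
  split; [|split; [|split; [|split; [|split; [|split]]]]]; try lra.
  - apply (clamped_coefficient _ (1/4000)). lra. intros. now apply HS.
  - apply (clamped_coefficient _ 14). lra. intros c s x v c' s' x' v' B B'.
    replace (_ - _) with ((x ^ 2 * s * c - x' ^ 2 * s' * c') + (l * fast l c s x v - l * fast l c' s' x' v')) by ring.
    apply Rle_trans with (1 := Rabs_triang _ _).
    assert (E1 := SQ _ _ _ _ _ _ _ _ B B'). destruct (HF _ _ _ _ _ _ _ _ B B') as [_ E2].
    assert (G := gap_ge0 c s x v c' s' x' v'). lra.
  - assert (H := PI_4). lra.
  - intros t x v x' v'. unfold clamped_slow, clamped.
    destruct (HS _ _ _ _ _ _ _ _ (clamped_box t x v) (clamped_box t x' v')) as [_ E].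
    rewrite gap_same in E.
    assert (B1 := clamp_lipschitz (1/2) (7/2) x x' ltac:(lra)).
    assert (B2 := clamp_lipschitz (-20) 20 v v' ltac:(lra)). lra.
  - intros t x v x' v'. unfold clamped_fast, clamped.
    destruct (HF _ _ _ _ _ _ _ _ (clamped_box t x v) (clamped_box t x' v')) as [_ E].
    rewrite gap_same in E.
    assert (B1 := clamp_lipschitz (1/2) (7/2) x x' ltac:(lra)).
    assert (B2 := clamp_lipschitz (-20) 20 v v' ltac:(lra)).
    destruct (clamped_box t x v) as (C1 & C2 & C3 & _). destruct (clamped_box t x' v') as (_ & _ & C3' & _).
    assert (E1 := sq_lipschitz _ _ _ _ C3 C3' C2 C1).
    set (y := clamp (1/2) (7/2) x) in *. set (y' := clamp (1/2) (7/2) x') in *.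
    set (w := clamp (-20) 20 v) in *. set (w' := clamp (-20) 20 v') in *.
    replace (_ - _) with ((y ^ 2 * sin t * cos t - y' ^ 2 * sin t * cos t) +
      (l * fast l (cos t) (sin t) y w - l * fast l (cos t) (sin t) y' w')) by ring.
    apply Rle_trans with (1 := Rabs_triang _ _).
    assert (U1 := Rabs_pos (x - x')). assert (U2 := Rabs_pos (v - v')). lra.
Qed.

Lemma root_range r : root r -> 1 <= r <= 3.
Proof. intros [-> | [-> | ->]]; lra. Qed.

(** A priori bounds: x moves little from x0 because the slow equation is small, and
    v is at most 49/4 + 1/4000 by the maximum principle. *)
Lemma drifting_inbox l x0 p X V : uniformly_small (1/4000) l -> 17/20 <= x0 <= 63/20 ->
  drifting_solution (clamped_slow l) (clamped_fast l) x0 p X V ->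
  (forall t, Rabs (X t - x0) <= 1/20) /\ (forall t, Rabs (V t) <= 19) /\ inbox X V /\
  (forall t, drifting l p X V t).
Proof.
  intros (Hl & HT & HB) Hx0 (pX & pV & X0 & dX & dV).
  assert (HS := HT slow ltac:(auto)). assert (HF := HT fast ltac:(auto)).
  assert (EX : forall t, Rabs (X t - x0) <= 1/20).
  { intros t. destruct (drift_bound (2 * PI) X _ p (1/4000) PI2_pos pX dX) as [_ E].
    - intros s. apply (proj1 (HS _ _ _ _ _ _ _ _ (clamped_box s (X s) (V s)) (clamped_box s (X s) (V s)))).
    - specialize (E t). rewrite X0 in E. assert (H := PI_4). lra. }
  assert (EV : forall t, Rabs (V t) <= 19).
  { apply (damped_bound (2 * PI) V (fun t => clamped_fast l t (X t) (V t)) 19 PI2_pos pV dV).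
    intros t. unfold clamped_fast, clamped.
    destruct (HF _ _ _ _ _ _ _ _ (clamped_box t (X t) (V t)) (clamped_box t (X t) (V t))) as [E _].
    destruct (clamped_box t (X t) (V t)) as (C1 & C2 & C3 & _).
    set (y := clamp (1/2) (7/2) (X t)) in *.
    apply Rle_trans with (1 := Rabs_triang _ _).
    assert (E1 : Rabs (y ^ 2 * sin t * cos t) <= 49/4); [|lra].
    rewrite !Rabs_mult, (Rabs_right (y ^ 2)) by nra.
    assert (0 <= Rabs (sin t) * Rabs (cos t) <= 1).
    { split. apply Rmult_le_pos; apply Rabs_pos. rewrite <- (Rmult_1_r 1).
      apply Rmult_le_compat; auto using Rabs_pos. }
    nra. }
  assert (B : inbox X V).
  { intros t. specialize (EX t). specialize (EV t). apply Rabs_le_between in EX. lra. }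
  split; [exact EX | split; [exact EV | split; [exact B|]]]. intros t.
  destruct (B t) as [B1 B2]. apply Rabs_le_between in B2.
  specialize (dX t). specialize (dV t). unfold clamped_slow, clamped_fast, clamped in dX, dV.
  rewrite (clamp_id _ _ _ B1), (clamp_id (-20) 20 (V t)) in dX, dV by lra.
  now split.
Qed.

(** [Psi] is periodic along the solution, so its derivative vanishes somewhere; there p
    balances the averaged function, whose sign is e. *)
Lemma drift_sign l p X V e : uniformly_small (1/4000) l -> (e = 1 \/ e = -1) ->
  periodic (2 * PI) X -> periodic (2 * PI) V -> inbox X V ->
  (forall t, drifting l p X V t) -> (forall t, 1/100 <= e * averaged (X t)) -> 0 < e * p.
Proof.
  intros (Hl & HT & HB) He pX pV B D HL.
  assert (bx : forall t, box (cos t) (sin t) (X t) (V t)) by (intros t; apply box_trig; apply B).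
  assert (dPs : forall t, is_derive (fun t => Psi l (cos t) (sin t) (X t) (V t)) t
    (l ^ 4 * averaged (X t) + l ^ 5 * rem_angle l (cos t) (sin t) (X t) (V t)
     - p * (1 + l * Psi_x1 l (cos t) (sin t) (X t) (V t)))).
  { intros t. destruct (HB _ _ _ _ (bx t)) as (_ & Y1 & Z1). apply Psi_derive; auto; lra. }
  destruct (periodic_rolle (2 * PI) (fun t => Psi l (cos t) (sin t) (X t) (V t))
    (fun t => l ^ 4 * averaged (X t) + l ^ 5 * rem_angle l (cos t) (sin t) (X t) (V t)
     - p * (1 + l * Psi_x1 l (cos t) (sin t) (X t) (V t))) PI2_pos) as [t Ht]; [|exact dPs|].
  { intros t. now rewrite cos_plus, sin_plus, cos_2PI, sin_2PI, !Rmult_1_r, !Rmult_0_r, Rminus_0_r, Rplus_0_r, pX, pV. }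
  destruct (HB _ _ _ _ (bx t)) as (Y1 & _ & _).
  destruct (HT rem_angle ltac:(auto) _ _ _ _ _ _ _ _ (bx t) (bx t)) as [E _]. specialize (HL t).
  set (q := 1 + l * Psi_x1 l (cos t) (sin t) (X t) (V t)) in *.
  set (w := rem_angle l (cos t) (sin t) (X t) (V t)) in *.
  assert (E1 : e * p * q = l ^ 4 * (e * averaged (X t) + e * (l * w))).
  { transitivity (e * (p * q)). ring.
    replace (p * q) with (l ^ 4 * averaged (X t) + l ^ 5 * w) by lra. ring. }
  assert (L4 : 0 < l ^ 4) by (apply pow_lt; lra).
  assert (0 < e * averaged (X t) + e * (l * w)).
  { apply Rabs_le_between in E. destruct He as [-> | ->]; lra. }
  assert (0 < e * p * q) by (rewrite E1; now apply Rmult_lt_0_compat).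
  apply (Rmult_lt_reg_r q); lra.
Qed.

(** The bounds are products of bounds of the four factors of [averaged]. *)
Lemma averaged_sign_change r : root r -> exists e, (e = 1 \/ e = -1) /\
  (forall x, r - 3/20 <= x <= r - 1/20 -> 1/100 <= e * averaged x) /\
  (forall x, r + 1/20 <= x <= r + 3/20 -> 1/100 <= - e * averaged x).
Proof.
  assert (A : forall a b a' b' x y x' y', 0 <= a <= x -> 0 <= b <= y -> 0 <= a' <= x' -> 0 <= b' <= y' ->
    a * b * (a' * b') <= x * y * (x' * y')).
  { intros. assert (0 <= a * b) by (apply Rmult_le_pos; lra). assert (0 <= a' * b') by (apply Rmult_le_pos; lra).
    apply Rmult_le_compat; auto; apply Rmult_le_compat; lra. }
  intros [-> | [-> | ->]]; [exists 1 | exists (-1) | exists 1]; (split; [auto|]); split; intros x Hx; unfold averaged.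
  - assert (H := A (17/20) (1/20) 1 2 x (1 - x) (2 - x) (3 - x) ltac:(lra) ltac:(lra) ltac:(lra) ltac:(lra)). lra.
  - assert (H := A 1 (1/20) (4/5) (9/5) x (x - 1) (2 - x) (3 - x) ltac:(lra) ltac:(lra) ltac:(lra) ltac:(lra)). lra.
  - assert (H := A (9/5) (4/5) (1/20) 1 x (x - 1) (2 - x) (3 - x) ltac:(lra) ltac:(lra) ltac:(lra) ltac:(lra)). lra.
  - assert (H := A 2 1 (1/20) (4/5) x (x - 1) (x - 2) (3 - x) ltac:(lra) ltac:(lra) ltac:(lra) ltac:(lra)). lra.
  - assert (H := A 2 1 (4/5) (1/20) x (x - 1) (x - 2) (3 - x) ltac:(lra) ltac:(lra) ltac:(lra) ltac:(lra)). lra.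
  - assert (H := A 3 2 1 (1/20) x (x - 1) (x - 2) (x - 3) ltac:(lra) ltac:(lra) ltac:(lra) ltac:(lra)). lra.
Qed.

Lemma lipschitz_continuity f : (forall x y, Rabs (f x - f y) <= Rabs (x - y)) -> continuity f.
Proof.
  intros H x. apply continuity_pt_filterlim, filterlim_locally. intros eps.
  exists eps. intros y Hy. apply Rle_lt_trans with (1 := H y x). exact Hy.
Qed.

Lemma profile_exists l r : uniformly_small (1/4000) l -> root r ->
  exists X V, profile l X V /\ periodic (2 * PI) X /\ periodic (2 * PI) V /\
    inbox X V /\ forall t, Rabs (X t - r) <= 3/20 /\ Rabs (V t) <= 19.
Proof.
  intros Ht Hr. assert (HS := clamped_slow_fast l Ht). assert (Hr' := root_range r Hr).
  assert (ex : forall x0, exists p, exists X V, drifting_solution (clamped_slow l) (clamped_fast l) x0 p X V).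
  { intros x0. apply (drifting_solution_exists _ _ _ _ x0 HS). }
  pose (p := fun x0 => proj1_sig (constructive_indefinite_description _ (ex x0))).
  assert (Hp : forall x0, exists X V, drifting_solution (clamped_slow l) (clamped_fast l) x0 (p x0) X V).
  { intros x0. unfold p. apply proj2_sig. }
  assert (cp : continuity p).
  { apply lipschitz_continuity. intros x y.
    destruct (Hp x) as (X & V & H), (Hp y) as (X' & V' & H').
    apply (drift_lipschitz _ _ _ _ _ _ _ _ _ _ _ _ HS H H'). }
  assert (sg : forall x0 e, 17/20 <= x0 <= 63/20 -> (e = 1 \/ e = -1) ->
     (forall x, Rabs (x - x0) <= 1/20 -> 1/100 <= e * averaged x) -> 0 < e * p x0).
  { intros x0 e Hx0 He HL. destruct (Hp x0) as (X & V & H).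
    destruct (drifting_inbox l x0 _ X V Ht Hx0 H) as (E & EV & B & D).
    destruct H as (pX & pV & _). apply (drift_sign l (p x0) X V e); auto. }
  destruct (averaged_sign_change r Hr) as (e & He & L1 & L2).
  assert (S1 : 0 < e * p (r - 1/10)).
  { apply sg; auto. lra. intros x Hx. apply Rabs_le_between in Hx. apply L1. lra. }
  assert (S2 : 0 < - e * p (r + 1/10)).
  { apply sg. lra. lra. intros x Hx. apply Rabs_le_between in Hx. apply L2. lra. }
  destruct (IVT_cor p (r - 1/10) (r + 1/10) cp) as (z & Hz & Ez). lra.
  { destruct He as [-> | ->]; nra. }
  destruct (Hp z) as (X & V & H). rewrite Ez in H.
  destruct (drifting_inbox l z 0 X V Ht ltac:(lra) H) as (E & EV & B & D).
  destruct H as (pX & pV & _). exists X, V. split; [exact D | split; [exact pX | split; [exact pV | split; [exact B|]]]].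
  intros t. split; [|apply EV]. specialize (E t). apply Rabs_le_between in E. apply Rabs_le. lra.
Qed.

(** * Inverse functions and derivatives of pairs *)

(** Used to pass between time and angle, in both directions. *)
Lemma increasing_inverse (f f' : R -> R) m : 0 < m ->
  (forall t, is_derive f t (f' t)) -> (forall t, m <= f' t) ->
  exists g : R -> R, (forall s, f (g s) = s) /\ (forall t, g (f t) = t) /\
    forall s, is_derive g s (/ f' (g s)).
Proof.
  intros Hm Hd Hb.
  assert (slope : forall a b, exists z, f b - f a = f' z * (b - a)).
  { intros a b. destruct (MVT_gen f a b f') as (z & _ & E).
    - intros; apply Hd.
    - intros t _. apply continuity_pt_filterlim, (is_derive_continuous f t _ (Hd t)).
    - now exists z. }
  assert (cf : continuity f).
  { intros t. apply continuity_pt_filterlim, (is_derive_continuous f t _ (Hd t)). }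
  assert (surj : forall s, exists t, f t = s).
  { intros s. set (k := Rabs (s - f 0) / m).
    assert (Hk : 0 <= k). { apply Rmult_le_pos. apply Rabs_pos. left. now apply Rinv_0_lt_compat. }
    assert (Ek : k * m = Rabs (s - f 0)) by (unfold k; field; lra).
    destruct (slope 0 k) as [z1 E1]. destruct (slope 0 (- k)) as [z2 E2].
    assert (A1 := Hb z1). assert (A2 := Hb z2).
    assert (T1 := Rle_abs (s - f 0)). assert (T2 := Rle_abs (- (s - f 0))). rewrite Rabs_Ropp in T2.
    assert (B1 : s <= f k) by nra. assert (B2 : f (- k) <= s) by nra.
    destruct (IVT_gen f (- k) k s cf) as (t & _ & Et).
    - split. apply Rle_trans with (1 := Rmin_l _ _). exact B2.
      apply Rle_trans with (2 := Rmax_r _ _). exact B1.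
    - now exists t. }
  assert (inj : forall a b, m * Rabs (b - a) <= Rabs (f b - f a)).
  { intros a b. destruct (slope a b) as [z E]. rewrite E, Rabs_mult. specialize (Hb z).
    rewrite (Rabs_right (f' z)) by lra. apply Rmult_le_compat_r; auto using Rabs_pos. }
  pose (g := fun s => proj1_sig (constructive_indefinite_description _ (surj s))).
  assert (fg : forall s, f (g s) = s) by (intros s; unfold g; apply proj2_sig).
  assert (gf : forall t, g (f t) = t).
  { intros t. apply Rminus_diag_uniq, Rabs_eq_0.
    specialize (inj t (g (f t))). rewrite fg, Rminus_diag, Rabs_R0 in inj.
    assert (H := Rabs_pos (g (f t) - t)). nra. }
  exists g. split; [exact fg | split; [exact gf |]].
  intros s. apply is_derive_Reals. intros eps Heps.
  set (t := g s). assert (Hl := Hb t).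
  assert (Hd' := proj1 (is_derive_Reals _ _ _) (Hd t)).
  destruct (Hd' (eps * (m * m))) as [del Hdel]. { apply Rmult_lt_0_compat; auto. now apply Rmult_lt_0_compat. }
  assert (Hdm : 0 < del * m) by (apply Rmult_lt_0_compat; auto; apply cond_pos).
  exists (mkposreal _ Hdm). intros h Hh0 Hh. simpl in Hh.
  set (k := g (s + h) - t).
  assert (Ek : f (t + k) - f t = h).
  { replace (t + k) with (g (s + h)) by (unfold k; ring). unfold t. rewrite !fg. ring. }
  assert (Hk0 : k <> 0). { intros E. rewrite E, Rplus_0_r in Ek. lra. }
  assert (Hk : Rabs k < del).
  { apply (Rmult_lt_reg_r m); auto. apply Rle_lt_trans with (2 := Hh). rewrite <- Ek.
    specialize (inj t (t + k)). replace (t + k - t) with k in inj by ring. lra. }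
  specialize (Hdel k Hk0 Hk). rewrite Ek in Hdel.
  destruct (slope t (t + k)) as [z Ez]. rewrite Ek in Ez. replace (t + k - t) with k in Ez by ring.
  assert (Hz := Hb z).
  replace (k / h - / f' t) with (- ((h / k - f' t) * (/ f' z * / f' t))).
  2:{ rewrite Ez. field. lra. }
  rewrite Rabs_Ropp, Rabs_mult.
  assert (I1 : 0 < / f' z <= / m). { split. apply Rinv_0_lt_compat; lra. apply Rinv_le_contravar; auto. }
  assert (I2 : 0 < / f' t <= / m). { split. apply Rinv_0_lt_compat; lra. apply Rinv_le_contravar; auto. }
  rewrite (Rabs_right (/ f' z * / f' t)) by nra.
  apply Rlt_le_trans with (eps * (m * m) * (/ f' z * / f' t)).
  - apply Rmult_lt_compat_r; auto. nra.
  - apply Rle_trans with (eps * (m * m) * (/ m * / m)).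
    + apply Rmult_le_compat_l. nra. apply Rmult_le_compat; lra.
    + right. field. lra.
Qed.

Lemma is_derive_pair {U W : NormedModule R_AbsRing} (f : R -> U) (g : R -> W) (t : R) df dg :
  is_derive f t df -> is_derive g t dg ->
  is_derive (fun t => (f t, g t)) t ((df, dg) : prod_NormedModule R_AbsRing U W).
Proof.
  intros Hf Hg.
  apply (filterdiff_comp'_2 f g (fun a b => (a, b)) t _ _ (fun a b => (a, b)) Hf Hg).
  apply (filterdiff_linear (fun w : prod_NormedModule R_AbsRing U W => (fst w, snd w))).
  apply is_linear_prod. apply is_linear_fst. apply is_linear_snd.
Qed.

Lemma is_derive_fst {U W : NormedModule R_AbsRing} (u : R -> prod_NormedModule R_AbsRing U W) (t : R) du :
  is_derive u t du -> is_derive (fun t => fst (u t)) t (fst du).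
Proof.
  intros H. apply (filterdiff_comp' u fst t _ fst H).
  apply (filterdiff_linear (fun w : prod_NormedModule R_AbsRing U W => fst w)), is_linear_fst.
Qed.

Lemma is_derive_snd {U W : NormedModule R_AbsRing} (u : R -> prod_NormedModule R_AbsRing U W) (t : R) du :
  is_derive u t du -> is_derive (fun t => snd (u t)) t (snd du).
Proof.
  intros H. apply (filterdiff_comp' u snd t _ snd H).
  apply (filterdiff_linear (fun w : prod_NormedModule R_AbsRing U W => snd w)), is_linear_snd.
Qed.

(** * The original system in polar form *)

(** sqrt 2 / 2, the common value of cos (pi/4) and sin (pi/4). *)
Definition hsqrt2 := sqrt 2 / 2.

Lemma hsqrt2_sq : hsqrt2 * hsqrt2 = 1/2.
Proof. unfold hsqrt2. assert (H := sqrt_sqrt 2 ltac:(lra)). nra. Qed.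
Lemma hsqrt2_pos : 0 < hsqrt2.
Proof. unfold hsqrt2. assert (H := sqrt_lt_R0 2 ltac:(lra)). lra. Qed.

Definition par_shift l := alpha * l ^ 4 * hsqrt2.
Definition par_a l := (sigma * l ^ 3 + kappa * l) / 2 - par_shift l.
Definition par_b l := (kappa * l - 3 * (sigma * l ^ 3)) / 2 + par_shift l.
Definition par_c l := (sigma * l ^ 3 + kappa * l) / 2 + par_shift l.

(** The parameters k = - kappa l, s = sigma l^3, A = alpha l^4, with A / sqrt 2 written
    as [par_shift l]. *)
Definition params_at l : params := (par_a l, par_b l, par_c l, sqrt 2).

(** The polar angle theta as a function of phi = pi/4 - 2 theta: one turn of phi is
    half a turn around the singular point, in the opposite direction. *)
Definition half_angle t := (PI / 4 - t) / 2.
Definition radius l x := sqrt (4 * hsqrt2 * (l * x)).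
Definition height l c x v := hsqrt2 * (1 + l * x * c + l ^ 2 * v).
Definition point_of l t x v : point := (radius l x * cos (half_angle t), radius l x * sin (half_angle t), height l (cos t) x v).

(** This says that (c, s) = (cos phi, sin phi) for the point (x1, x2), in a form that is
    linear in (c, s) and keeps the computations with the vector field polynomial. *)
Definition aligned x1 x2 c s := x1 * s + x2 * c = hsqrt2 * (x1 - x2) /\ x1 * c - x2 * s = hsqrt2 * (x1 + x2).

(** The planar part of the field is a dilation plus a rotation. *)
Lemma field_aligned l x1 x2 c s x v : aligned x1 x2 c s ->
  field (params_at l) (x1, x2, height l c x v) =
    (hsqrt2 * (l * growth l c s * x1 + speed l c s x v * x2),
     hsqrt2 * (l * growth l c s * x2 - speed l c s x v * x1),
     x1 * x2 - l * x * c - l ^ 2 * v).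
Proof.
  intros [H1 H2]. unfold field, params_at. 
  assert (Hh := sqrt_sqrt 2 ltac:(lra)).
  f_equal; [f_equal|].
  - assert (E : l * growth l c s * x1 + speed l c s x v * x2 = 
      - kappa * l * (x1 * s + x2 * c) - sigma * l ^ 3 * (x1 * c - x2 * s) + alpha * l ^ 4 * x1
      + x2 * (1 + l * x * c + l ^ 2 * v - l ^ 3 * detuning l)) by (unfold growth, growth2, speed, speed1, speed2; ring).
    rewrite E, H1, H2. unfold par_a, par_shift, height, detuning. unfold hsqrt2. field_modulo Hh.
  - assert (E : l * growth l c s * x2 - speed l c s x v * x1 = 
      kappa * l * (x1 * c - x2 * s) - sigma * l ^ 3 * (x1 * s + x2 * c) + alpha * l ^ 4 * x2
      - x1 * (1 + l * x * c + l ^ 2 * v - l ^ 3 * detuning l)) by (unfold growth, growth2, speed, speed1, speed2; ring).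
    rewrite E, H1, H2. unfold par_b, par_c, par_shift, height, detuning. unfold hsqrt2. field_modulo Hh.
  - unfold height, hsqrt2. field_modulo Hh.
Qed.

(** * From profiles to closed orbits *)

Lemma trig_PI4 : cos (PI / 4) = hsqrt2 /\ sin (PI / 4) = hsqrt2.
Proof.
  rewrite cos_PI4, sin_PI4. assert (H := sqrt_sqrt 2 ltac:(lra)). assert (H' := sqrt_lt_R0 2 ltac:(lra)).
  assert (1 / sqrt 2 = hsqrt2); [|tauto]. unfold hsqrt2. apply (Rmult_eq_reg_r (sqrt 2)). field_simplify; lra. lra.
Qed.

Lemma point_aligned t r : aligned (r * cos (half_angle t)) (r * sin (half_angle t)) (cos t) (sin t).
Proof.
  assert (E : t + half_angle t = PI / 4 - half_angle t) by (unfold half_angle; field).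
  destruct trig_PI4 as [C S]. split.
  - transitivity (r * sin (t + half_angle t)). { rewrite sin_plus. ring. }
    rewrite E, sin_minus, C, S. ring.
  - transitivity (r * cos (t + half_angle t)). { rewrite cos_plus. ring. }
    rewrite E, cos_minus, C, S. ring.
Qed.

Lemma radius_sq l x : 0 < l * x -> radius l x * radius l x = 4 * hsqrt2 * (l * x).
Proof. intros H. apply sqrt_sqrt. assert (P := hsqrt2_pos). nra. Qed.

Lemma radius_pos l x : 0 < l * x -> 0 < radius l x.
Proof. intros H. apply sqrt_lt_R0. assert (P := hsqrt2_pos). nra. Qed.

Lemma point_product l t x : 0 < l * x ->
  radius l x * cos (half_angle t) * (radius l x * sin (half_angle t)) = l * x * (cos t - sin t).
Proof.
  intros H. transitivity (radius l x * radius l x * (sin (2 * half_angle t) / 2)). { rewrite sin_2a. field. }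
  rewrite radius_sq by auto. replace (2 * half_angle t) with (PI / 4 - t) by (unfold half_angle; field).
  destruct trig_PI4 as [C S]. rewrite sin_minus, C, S.
  transitivity (2 * (hsqrt2 * hsqrt2) * (l * x * (cos t - sin t))). field. rewrite hsqrt2_sq. field.
Qed.

(** The third equation of the system, in the coordinates x and v. *)
Lemma height_rate l c s x v : s * s = 1 - c * c ->
  l * x * (l * growth l c s * c - s * speed l c s x v) + l ^ 2 * fast_rate l c s x v = - (l * x * s) - l ^ 2 * v.
Proof. intros H. unfold growth, growth2, speed, speed1, speed2, fast_rate, fast_rate1, fast_rate2. ring [H]. Qed.

Lemma lift_solution l ph X V t : 0 < l -> 0 < X t ->
  is_derive ph t (2 * hsqrt2 * speed l (cos (ph t)) (sin (ph t)) (X t) (V t)) ->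
  is_derive X t (2 * hsqrt2 * (l * (X t * growth l (cos (ph t)) (sin (ph t))))) ->
  is_derive V t (2 * hsqrt2 * fast_rate l (cos (ph t)) (sin (ph t)) (X t) (V t)) ->
  is_derive (fun t => point_of l (ph t) (X t) (V t) : point) t (field (params_at l) (point_of l (ph t) (X t) (V t))).
Proof.
  intros Hl HX dph dX dV. assert (Hh := hsqrt2_pos).
  assert (HlX : 0 < l * X t) by now apply Rmult_lt_0_compat.
  set (y := speed l (cos (ph t)) (sin (ph t)) (X t) (V t)) in *.
  set (e := growth l (cos (ph t)) (sin (ph t))) in *.
  set (w := fast_rate l (cos (ph t)) (sin (ph t)) (X t) (V t)) in *.
  assert (dr : is_derive (fun t => radius l (X t)) t (hsqrt2 * (l * e) * radius l (X t))).
  { unfold radius. auto_derive. { split; [now exists (2 * hsqrt2 * (l * (X t * e)))|]. split; auto. nra. }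
    replace (Derive (fun x => X x) t) with (2 * hsqrt2 * (l * (X t * e))) by (symmetry; exact (is_derive_unique X t _ dX)).
    fold (radius l (X t)). assert (Hr := radius_pos l (X t) HlX).
    apply (Rmult_eq_reg_r (2 * radius l (X t))); [|lra]. field_simplify; [|lra].
    transitivity (2 * hsqrt2 * l * e * (radius l (X t) * radius l (X t))); [|ring].
    rewrite radius_sq by auto. ring. }
  assert (dh : is_derive (fun t => half_angle (ph t)) t (- (hsqrt2 * y))).
  { unfold half_angle. auto_derive. { now exists (2 * hsqrt2 * y). }
    replace (Derive (fun x => ph x) t) with (2 * hsqrt2 * y) by (symmetry; exact (is_derive_unique ph t _ dph)). field. }
  unfold point_of. rewrite (field_aligned l _ _ _ _ _ _ (point_aligned (ph t) (radius l (X t)))).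
  fold y e.
  rewrite point_product by auto.
  apply is_derive_pair. apply is_derive_pair.
  - replace (hsqrt2 * _) with (hsqrt2 * (l * e) * radius l (X t) * cos (half_angle (ph t)) + radius l (X t) * (- sin (half_angle (ph t)) * - (hsqrt2 * y))) by ring.
    apply (is_derive_mult (fun t => radius l (X t)) (fun t => cos (half_angle (ph t)))); auto.
    + replace (- sin (half_angle (ph t)) * - (hsqrt2 * y)) with (scal (- (hsqrt2 * y)) (- sin (half_angle (ph t)))) by (unfold scal; simpl; unfold mult; simpl; ring).
      apply (is_derive_comp cos (fun t => half_angle (ph t))); auto. apply is_derive_cos.
    + intros; apply Rmult_comm.
  - replace (hsqrt2 * _) with (hsqrt2 * (l * e) * radius l (X t) * sin (half_angle (ph t)) + radius l (X t) * (cos (half_angle (ph t)) * - (hsqrt2 * y))) by ring.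
    apply (is_derive_mult (fun t => radius l (X t)) (fun t => sin (half_angle (ph t)))); auto.
    + replace (cos (half_angle (ph t)) * - (hsqrt2 * y)) with (scal (- (hsqrt2 * y)) (cos (half_angle (ph t)))) by (unfold scal; simpl; unfold mult; simpl; ring).
      apply (is_derive_comp sin (fun t => half_angle (ph t))); auto. apply is_derive_sin.
    + intros; apply Rmult_comm.
  - unfold height. auto_derive.
    { repeat split; auto. now exists (2 * hsqrt2 * (l * (X t * e))). now exists (2 * hsqrt2 * y). now exists (2 * hsqrt2 * w). }
    replace (Derive (fun x => ph x) t) with (2 * hsqrt2 * y) by (symmetry; exact (is_derive_unique ph t _ dph)).
    replace (Derive (fun x => X x) t) with (2 * hsqrt2 * (l * (X t * e))) by (symmetry; exact (is_derive_unique X t _ dX)).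
    replace (Derive (fun x => V x) t) with (2 * hsqrt2 * w) by (symmetry; exact (is_derive_unique V t _ dV)).
    transitivity (2 * (hsqrt2 * hsqrt2) * (l * X t * (l * e * cos (ph t) - sin (ph t) * y) + l ^ 2 * w)). { ring. }
    rewrite hsqrt2_sq. unfold e, y, w. rewrite (height_rate l _ _ _ _ (sin_sq (ph t))). field.
Qed.

Definition orbit l X V (q : point) : Prop := exists t, q = point_of l t (X t) (V t).

Lemma fast_rate_quotient l c s x v : speed l c s x v <> 0 ->
  - v + (x ^ 2 * s * c + l * fast l c s x v) = fast_rate l c s x v / speed l c s x v.
Proof. intros H. unfold fast, fast_rate. unfold speed in *. field. auto. Qed.

Lemma speed_ex_derive l (C S X V : R -> R) t : ex_derive C t -> ex_derive S t -> ex_derive X t -> ex_derive V t ->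
  ex_derive (fun t => speed l (C t) (S t) (X t) (V t)) t.
Proof. intros HC HS HX HV. unfold speed, speed1, speed2, kappa. auto_derive. repeat split; auto. Qed.

Lemma tight_speed l X V : uniformly_small (1/4000) l -> inbox X V -> forall t, 1/2 <= speed l (cos t) (sin t) (X t) (V t) <= 3/2.
Proof.
  intros (Hl & HT & HB) B t. destruct (B t) as [B1 B2].
  destruct (HB _ _ _ _ (box_trig t _ _ B1 B2)) as (_ & Y & _). exact Y.
Qed.

Lemma hsqrt2_bounds : 1/2 <= hsqrt2 <= 1.
Proof. assert (H := hsqrt2_sq). assert (P := hsqrt2_pos). nra. Qed.

(** Time is the integral of the inverse angular speed; its inverse function turns a
    profile into a solution.  The orbit closes after two turns of phi: after one
    turn (x, y) has become (- x, - y). *)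
Lemma profile_orbit l X V : uniformly_small (1/4000) l -> profile l X V ->
  periodic (2 * PI) X -> periodic (2 * PI) V -> inbox X V ->
  periodic_orbit_around (params_at l) (orbit l X V).
Proof.
  intros Ht HP pX pV B. assert (HY := tight_speed l X V Ht B). assert (Hl := proj1 Ht).
  assert (Hh := hsqrt2_bounds).
  set (y := fun t => speed l (cos t) (sin t) (X t) (V t)).
  set (f' := fun t => / (2 * hsqrt2 * y t)).
  assert (eX : forall t, ex_derive X t) by (intros t; destruct (HP t) as [D _]; eexists; exact D).
  assert (eV : forall t, ex_derive V t) by (intros t; destruct (HP t) as [_ D]; eexists; exact D).
  assert (Hf : forall t, 1/3 <= f' t).
  { intros t. unfold f'. specialize (HY t). fold (y t) in HY. replace (1/3) with (/ 3) by field.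
    apply Rinv_le_contravar; nra. }
  assert (cf : forall t, continuous f' t).
  { intros t. apply (@ex_derive_continuous R_AbsRing R_NormedModule f' t).
    apply ex_derive_inv.
    - apply (ex_derive_mult (fun _ => 2 * hsqrt2) y). apply ex_derive_const.
      apply speed_ex_derive; auto; auto_derive; auto.
    - specialize (HY t). fold (y t) in HY. nra. }
  set (clock := fun t => RInt f' 0 t).
  assert (dc : forall t, is_derive clock t (f' t)) by (intros t; now apply is_derive_primitive).
  destruct (increasing_inverse clock f' (1/3) ltac:(lra) dc Hf) as (g & cg & gc & dg).
  assert (pf : periodic (2 * PI) f').
  { intros t. unfold f', y. now rewrite cos_plus, sin_plus, cos_2PI, sin_2PI, !Rmult_1_r, !Rmult_0_r, Rminus_0_r, Rplus_0_r, pX, pV. }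
  set (T0 := clock (4 * PI)).
  assert (c0 : clock 0 = 0) by (unfold clock; rewrite RInt_point; reflexivity).
  assert (pc : forall t, clock (t + 4 * PI) = clock t + T0).
  { intros t. assert (E : clock (t + 4 * PI) - clock t = clock (0 + 4 * PI) - clock 0).
    { apply (zero_derive_const (fun t => clock (t + 4 * PI) - clock t)). intros s.
      replace 0 with (f' (s + 4 * PI) - f' s).
      - apply (is_derive_minus (fun t => clock (t + 4 * PI)) clock); auto. apply (is_derive_shift clock). apply dc.
      - replace (4 * PI) with (INR 2 * (2 * PI)) by (simpl; ring). rewrite (periodic_INR _ _ 2 s pf). ring. }
    rewrite c0, Rplus_0_l in E. fold T0 in E. lra. }
  assert (HT0 : 0 < T0).
  { destruct (MVT_gen clock 0 (4 * PI) f') as (z & _ & E).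
    - intros; apply dc.
    - intros t _. apply continuity_pt_filterlim, (is_derive_continuous clock t _ (dc t)).
    - fold T0 in E. rewrite c0 in E. specialize (Hf z). assert (P := PI_RGT_0). nra. }
  assert (pg : forall t, g (t + T0) = g t + 4 * PI).
  { intros t. rewrite <- (cg t) at 1. rewrite <- pc. apply gc. }
  assert (p4 : forall h, periodic (2 * PI) h -> forall t, h (t + 4 * PI) = h t).
  { intros h Hh' t. replace (4 * PI) with (INR 2 * (2 * PI)) by (simpl; ring). now apply periodic_INR. }
  set (u := fun t => point_of l (g t) (X (g t)) (V (g t))).
  assert (h4 : forall t, half_angle (t + 4 * PI) = half_angle t - 2 * PI) by (intros; unfold half_angle; field).
  assert (cos_m : forall t, cos (t - 2 * PI) = cos t).
  { intros t. rewrite <- (cos_period (t - 2 * PI) 1). f_equal. simpl. ring. }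
  assert (sin_m : forall t, sin (t - 2 * PI) = sin t).
  { intros t. rewrite <- (sin_period (t - 2 * PI) 1). f_equal. simpl. ring. }
  assert (g0 : g 0 = 0) by (rewrite <- c0 at 1; apply gc).
  assert (X0 : forall t, 0 < l * X t).
  { intros t. destruct (B t) as [B1 _]. apply Rmult_lt_0_compat; lra. }
  exists T0, u. split; [split; [|split; [exact HT0 | split]]|split].
  - intros t. assert (Ey := HY (g t)). fold (y (g t)) in Ey.
    assert (Eg : / f' (g t) = 2 * hsqrt2 * y (g t)).
    { unfold f'. rewrite Rinv_inv. reflexivity. }
    assert (Dg := dg t). rewrite Eg in Dg.
    destruct (HP (g t)) as [DX DV]. rewrite Rminus_0_r in DX.
    apply lift_solution; auto.
    + lra.
    + destruct (B (g t)); lra.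
    + replace (2 * hsqrt2 * _) with (scal (2 * hsqrt2 * y (g t)) (l * slow l (cos (g t)) (sin (g t)) (X (g t)) (V (g t)))).
      * now apply (is_derive_comp X g).
      * unfold scal; simpl; unfold mult; simpl. unfold slow. fold (y (g t)). field. lra.
    + replace (2 * hsqrt2 * fast_rate _ _ _ _ _) with (scal (2 * hsqrt2 * y (g t)) (- V (g t) + (X (g t) ^ 2 * sin (g t) * cos (g t)
         + l * fast l (cos (g t)) (sin (g t)) (X (g t)) (V (g t))))).
      * now apply (is_derive_comp V g).
      * rewrite fast_rate_quotient by (fold (y (g t)); lra). fold (y (g t)).
        unfold scal; simpl; unfold mult; simpl. field. lra.
  - intros t. unfold u, point_of. rewrite pg, (p4 X pX), (p4 V pV), h4, cos_m, sin_m.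
    replace (cos (g t + 4 * PI)) with (cos (g t)); auto.
    symmetry. replace (g t + 4 * PI) with (g t + 2 * INR 2 * PI) by (simpl; ring). apply cos_period.
  - exists (clock (2 * PI)). intros E. unfold u in E. rewrite gc, g0 in E.
    unfold point_of in E. injection E as E1 E2 _.
    assert (X2 : X (2 * PI) = X 0) by (rewrite <- (Rplus_0_l (2 * PI)); apply pX).
    rewrite X2 in E1, E2. assert (Hr := radius_pos l (X 0) (X0 0)).
    replace (half_angle (2 * PI)) with (half_angle 0 - PI) in E1, E2 by (unfold half_angle; field).
    rewrite cos_minus, cos_PI, sin_PI in E1. rewrite sin_minus, cos_PI, sin_PI in E2.
    assert (C0 : cos (half_angle 0) = 0) by nra. assert (S0 : sin (half_angle 0) = 0) by nra.
    assert (Hc := sin_sq (half_angle 0)). rewrite C0, S0 in Hc. lra.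
  - exists (fun t => radius l (X (g t))), (fun t => half_angle (g t)). split.
    + intros t. split; [now apply radius_pos | split; [|split; reflexivity]].
      apply (@ex_derive_continuous R_AbsRing R_NormedModule (fun t => half_angle (g t)) t).
      unfold half_angle. auto_derive. eexists. apply dg.
    + rewrite <- (Rplus_0_l T0), pg, h4. assert (P := PI_RGT_0). lra.
  - intros q. split; intros [t E].
    + exists (clock t). unfold u. now rewrite gc.
    + exists (g t). exact E.
Qed.

(** * From closed orbits to profiles *)

Definition energy (q : point) : R := hsqrt2 / 2 * (fst (fst q) * fst (fst q) + snd (fst q) * snd (fst q)).
Definition ecos (q : point) : R :=
  (fst (fst q) * fst (fst q) - snd (fst q) * snd (fst q) + 2 * (fst (fst q) * snd (fst q))) / 4.
Definition esin (q : point) : R :=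
  (fst (fst q) * fst (fst q) - snd (fst q) * snd (fst q) - 2 * (fst (fst q) * snd (fst q))) / 4.
Definition excess (q : point) : R := 2 * hsqrt2 * snd q - 1 - ecos q.

(** The isolating neighborhood of the limit cycle near the root r. *)
Definition region l r (q : point) : Prop :=
  l * (r - 1/5) < energy q < l * (r + 1/5) /\ - (20 * l ^ 2) < excess q < 20 * l ^ 2.

Definition cos_coord q := ecos q / energy q.
Definition sin_coord q := esin q / energy q.
Definition slow_coord l q := energy q / l.
Definition fast_coord l q := excess q / l ^ 2.

(** The functions [cos_coord] and [sin_coord] of a point are the cosine and the sine
    of phi, without choosing phi. *)
Lemma coordinates_aligned (q : point) : 0 < energy q -> aligned (fst (fst q)) (snd (fst q)) (cos_coord q) (sin_coord q).
Proof.
  intros H. destruct q as [[x1 x2] z]. unfold cos_coord, sin_coord, energy, ecos, esin in *. simpl in *.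
  assert (Hh := hsqrt2_pos). assert (Q : x1 * x1 + x2 * x2 <> 0) by (intros E; rewrite E in H; lra).
  assert (K := hsqrt2_sq).
  split.
  - transitivity (2 * (hsqrt2 * hsqrt2) * (x1 - x2) / (2 * hsqrt2)); [rewrite hsqrt2_sq|]; field; lra.
  - transitivity (2 * (hsqrt2 * hsqrt2) * (x1 + x2) / (2 * hsqrt2)); [rewrite hsqrt2_sq|]; field; lra.
Qed.

Lemma aligned_unique x1 x2 c s c' s' : 0 < x1 * x1 + x2 * x2 ->
  aligned x1 x2 c s -> aligned x1 x2 c' s' -> c = c' /\ s = s'.
Proof.
  intros H [A1 A2] [B1 B2]. split; apply (Rmult_eq_reg_l (x1 * x1 + x2 * x2)); try lra.
  - transitivity (x2 * (x1 * s + x2 * c) + x1 * (x1 * c - x2 * s)). ring. rewrite A1, A2, <- B1, <- B2. ring.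
  - transitivity (x1 * (x1 * s + x2 * c) - x2 * (x1 * c - x2 * s)). ring. rewrite A1, A2, <- B1, <- B2. ring.
Qed.

Lemma aligned_circle x1 x2 c s : 0 < x1 * x1 + x2 * x2 -> aligned x1 x2 c s -> s * s = 1 - c * c.
Proof.
  intros H [A1 A2].
  assert (E : (x1 * x1 + x2 * x2) * (s * s + c * c) = x1 * x1 + x2 * x2).
  { transitivity ((x1 * s + x2 * c) * (x1 * s + x2 * c) + (x1 * c - x2 * s) * (x1 * c - x2 * s)). ring.
    rewrite A1, A2. transitivity (2 * (hsqrt2 * hsqrt2) * (x1 * x1 + x2 * x2)). ring. rewrite hsqrt2_sq. field. }
  apply (Rmult_eq_reg_l (x1 * x1 + x2 * x2)); lra.
Qed.

Lemma region_box l r q : 0 < l -> root r -> region l r q ->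
  0 < energy q /\ 1/2 <= slow_coord l q <= 7/2 /\ Rabs (fast_coord l q) <= 20 /\ Rabs (slow_coord l q - r) <= 1/5 /\
  box (cos_coord q) (sin_coord q) (slow_coord l q) (fast_coord l q).
Proof.
  intros Hl Hr [[E1 E2] [V1 V2]]. assert (Hr' := root_range r Hr).
  assert (E0 : 0 < energy q) by nra.
  assert (Ex : energy q = slow_coord l q * l) by (unfold slow_coord; field; lra).
  assert (Hl2 : 0 < l ^ 2) by (apply pow_lt; lra).
  assert (Ev : excess q = fast_coord l q * l ^ 2) by (unfold fast_coord; field; lra).
  assert (X1 : r - 1/5 < slow_coord l q). { apply (Rmult_lt_reg_r l); lra. }
  assert (X2 : slow_coord l q < r + 1/5). { apply (Rmult_lt_reg_r l); lra. }
  assert (Y1 : - 20 < fast_coord l q). { apply (Rmult_lt_reg_r (l ^ 2)); lra. }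
  assert (Y2 : fast_coord l q < 20). { apply (Rmult_lt_reg_r (l ^ 2)); lra. }
  assert (Bx : 1/2 <= slow_coord l q <= 7/2) by lra.
  assert (Bv : Rabs (fast_coord l q) <= 20) by (apply Rabs_le; lra).
  split; [exact E0 | split; [exact Bx | split; [exact Bv | split]]].
  - apply Rabs_le; lra.
  - assert (Q : 0 < fst (fst q) * fst (fst q) + snd (fst q) * snd (fst q)).
    { unfold energy in E0. assert (Hh := hsqrt2_pos). apply (Rmult_lt_reg_l (hsqrt2 / 2)); lra. }
    assert (C := aligned_circle _ _ _ _ Q (coordinates_aligned q E0)).
    repeat split; try apply Bx; auto; apply Rabs_le; nra.
Qed.

Lemma point_height l q : l <> 0 -> 0 < energy q ->
  q = (fst (fst q), snd (fst q), height l (cos_coord q) (slow_coord l q) (fast_coord l q)).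
Proof.
  intros Hl HE. destruct q as [[x1 x2] z]. simpl. f_equal.
  unfold height, slow_coord, cos_coord, fast_coord, excess. simpl.
  transitivity (2 * (hsqrt2 * hsqrt2) * z). { rewrite hsqrt2_sq. field. }
  field. split; auto. lra.
Qed.


Definition growth_at l (q : point) := growth l (cos_coord q) (sin_coord q).
Definition speed_at l (q : point) := speed l (cos_coord q) (sin_coord q) (slow_coord l q) (fast_coord l q).

Lemma solution_components l u t : l <> 0 -> 0 < energy (u t) -> solution (params_at l) u ->
  is_derive (fun t => fst (fst (u t))) t
    (hsqrt2 * (l * growth_at l (u t) * fst (fst (u t)) + speed_at l (u t) * snd (fst (u t)))) /\
  is_derive (fun t => snd (fst (u t))) t
    (hsqrt2 * (l * growth_at l (u t) * snd (fst (u t)) - speed_at l (u t) * fst (fst (u t)))) /\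
  is_derive (fun t => snd (u t)) t
    (fst (fst (u t)) * snd (fst (u t)) - l * slow_coord l (u t) * cos_coord (u t) - l ^ 2 * fast_coord l (u t)).
Proof.
  intros Hl HE Hu. specialize (Hu t).
  assert (F := field_aligned l _ _ _ _ (slow_coord l (u t)) (fast_coord l (u t)) (coordinates_aligned (u t) HE)).
  rewrite <- point_height in F by auto. rewrite F in Hu. clear F.
  assert (D1 := is_derive_fst _ _ _ Hu). assert (D2 := is_derive_snd _ _ _ Hu).
  split; [|split].
  - exact (is_derive_fst _ _ _ D1).
  - exact (is_derive_snd _ _ _ D1).
  - exact D2.
Qed.

Lemma profile_rates l u t : l <> 0 -> 0 < energy (u t) -> solution (params_at l) u ->
  is_derive (fun t => slow_coord l (u t)) t (2 * hsqrt2 * (l * (slow_coord l (u t) * growth_at l (u t)))) /\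
  is_derive (fun t => fast_coord l (u t)) t (2 * hsqrt2 * fast_rate l (cos_coord (u t)) (sin_coord (u t)) (slow_coord l (u t)) (fast_coord l (u t))).
Proof.
  intros Hl HE Hu.
  destruct (solution_components l u t Hl HE Hu) as (D1 & D2 & D3).
  assert (Q : 0 < fst (fst (u t)) * fst (fst (u t)) + snd (fst (u t)) * snd (fst (u t))).
  { unfold energy in HE. assert (Hh := hsqrt2_pos). apply (Rmult_lt_reg_l (hsqrt2 / 2)); lra. }
  assert (Hc := aligned_circle _ _ _ _ Q (coordinates_aligned (u t) HE)).
  assert (Ec : ecos (u t) = energy (u t) * cos_coord (u t)) by (unfold cos_coord; field; lra).
  assert (Es : esin (u t) = energy (u t) * sin_coord (u t)) by (unfold sin_coord; field; lra).
  assert (Ex : energy (u t) = l * slow_coord l (u t)) by (unfold slow_coord; field; auto).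
  set (a := growth_at l (u t)) in *. set (b := speed_at l (u t)) in *.
  set (dx := hsqrt2 * (l * a * fst (fst (u t)) + b * snd (fst (u t)))) in *.
  set (dy := hsqrt2 * (l * a * snd (fst (u t)) - b * fst (fst (u t)))) in *.
  set (dz := fst (fst (u t)) * snd (fst (u t)) - l * slow_coord l (u t) * cos_coord (u t) - l ^ 2 * fast_coord l (u t)) in *.
  pose (x1 := fun t => fst (fst (u t))). pose (x2 := fun t => snd (fst (u t))). pose (x3 := fun t => snd (u t)).
  assert (Ux : Derive (fun t => x1 t) t = dx) by exact (is_derive_unique x1 t _ D1).
  assert (Uy : Derive (fun t => x2 t) t = dy) by exact (is_derive_unique x2 t _ D2).
  assert (Uz : Derive (fun t => x3 t) t = dz) by exact (is_derive_unique x3 t _ D3).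
  split.
  - apply (is_derive_ext (fun t => hsqrt2 / 2 * (x1 t * x1 t + x2 t * x2 t) / l)); [reflexivity|].
    auto_derive.
    { repeat split; try (exists dx; exact D1); try (exists dy; exact D2). }
    rewrite Ux, Uy. unfold dx, dy, x1, x2.
    transitivity (2 * hsqrt2 * a * energy (u t)); [unfold energy; field; auto | rewrite Ex; ring].
  - apply (is_derive_ext (fun t => (2 * hsqrt2 * x3 t - 1 - (x1 t * x1 t - x2 t * x2 t + 2 * (x1 t * x2 t)) / 4) / l ^ 2)); [reflexivity|].
    auto_derive.
    { repeat split; try (exists dx; exact D1); try (exists dy; exact D2); try (exists dz; exact D3). }
    rewrite Ux, Uy, Uz.
    apply (Rmult_eq_reg_r (l ^ 2)); [|now apply pow_nonzero].
    assert (R := height_rate l (cos_coord (u t)) (sin_coord (u t)) (slow_coord l (u t)) (fast_coord l (u t)) Hc).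
    transitivity (2 * hsqrt2 * (- (l * slow_coord l (u t) * sin_coord (u t)) - l ^ 2 * fast_coord l (u t)
       - l * slow_coord l (u t) * (l * a * cos_coord (u t) - sin_coord (u t) * b))).
    2:{ rewrite <- R. fold (growth_at l (u t)) (speed_at l (u t)) a b. ring. }
    rewrite <- Ex.
    transitivity (2 * hsqrt2 * (dz - (l * a * ecos (u t) - esin (u t) * b))).
    + unfold dx, dy, ecos, esin, x1, x2. field. auto.
    + unfold dz. rewrite <- Ex.
      replace (fst (fst (u t)) * snd (fst (u t))) with (ecos (u t) - esin (u t)) by (unfold ecos, esin; field).
      rewrite Ec, Es. ring.
Qed.

(** In the region the angular speed is positive, so the integral phi of the speed is
    a strictly increasing function of time with an inverse.  That phi is the angle of the
    solution follows because the planar vector, rotated back by the polar angle and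
    divided by its length, is constant. *)
Lemma orbit_profile l r gamma : uniformly_small (1/4000) l -> root r ->
  periodic_orbit_around (params_at l) gamma -> contained_in gamma (region l r) ->
  exists X V L, same_set gamma (orbit l X V) /\ profile l X V /\ inbox X V /\
    (forall t, Rabs (X t - r) <= 1/5) /\ 0 < L /\
    periodic L X /\ periodic L V /\ periodic L cos /\ periodic L sin.
Proof.
  intros Ht Hr (T & u & (Hu & HT & pu & _) & (rho & theta & Hpol & _) & Hg) HN.
  assert (Hl := proj1 Ht). assert (Hh := hsqrt2_bounds).
  assert (reg : forall t, region l r (u t)). { intros t. apply HN, Hg. now exists t. }
  assert (bx := fun t => region_box l r (u t) (proj1 Hl) Hr (reg t)).
  assert (HE : forall t, 0 < energy (u t)) by (intros t; apply bx).
  assert (HQ : forall t, 0 < fst (fst (u t)) * fst (fst (u t)) + snd (fst (u t)) * snd (fst (u t))).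
  { intros t. specialize (HE t). unfold energy in HE. apply (Rmult_lt_reg_l (hsqrt2 / 2)); lra. }
  assert (Hl0 : l <> 0) by lra.
  assert (comp := fun t => solution_components l u t Hl0 (HE t) Hu).
  assert (rates := fun t => profile_rates l u t Hl0 (HE t) Hu).
  set (w := fun t => speed_at l (u t)).
  assert (Hw : forall t, 1/2 <= w t <= 3/2).
  { intros t. destruct Ht as (_ & _ & HB). apply (HB (cos_coord (u t)) (sin_coord (u t)) (slow_coord l (u t)) (fast_coord l (u t))), bx. }
  assert (cw : forall t, continuous (fun t => 2 * hsqrt2 * w t) t).
  { intros t. apply (@ex_derive_continuous R_AbsRing R_NormedModule (fun t => 2 * hsqrt2 * w t) t).
    apply (ex_derive_mult (fun _ => 2 * hsqrt2) w). apply ex_derive_const.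
    destruct (comp t) as (D1 & D2 & D3).
    pose (x1 := fun t => fst (fst (u t))). pose (x2 := fun t => snd (fst (u t))).
    assert (E1 : ex_derive x1 t) by (eexists; exact D1). assert (E2 : ex_derive x2 t) by (eexists; exact D2).
    assert (ee : ex_derive (fun t => energy (u t)) t).
    { apply (ex_derive_ext (fun t => hsqrt2 / 2 * (x1 t * x1 t + x2 t * x2 t))); [reflexivity|]. auto_derive. repeat split; try exact E1; exact E2. }
    apply speed_ex_derive.
    - apply (ex_derive_div (fun t => ecos (u t)) (fun t => energy (u t))); auto.
      + apply (ex_derive_ext (fun t => (x1 t * x1 t - x2 t * x2 t + 2 * (x1 t * x2 t)) / 4)); [reflexivity|]. auto_derive. repeat split; try exact E1; exact E2.
      + apply Rgt_not_eq, HE.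
    - apply (ex_derive_div (fun t => esin (u t)) (fun t => energy (u t))); auto.
      + apply (ex_derive_ext (fun t => (x1 t * x1 t - x2 t * x2 t - 2 * (x1 t * x2 t)) / 4)); [reflexivity|]. auto_derive. repeat split; try exact E1; exact E2.
      + apply Rgt_not_eq, HE.
    - exact (ex_intro _ _ (proj1 (rates t))).
    - exact (ex_intro _ _ (proj2 (rates t))). }
  destruct (Hpol 0) as (Hrho & _ & Hx0 & Hy0).
  set (ph := fun t => (PI / 4 - 2 * theta 0) + RInt (fun t => 2 * hsqrt2 * w t) 0 t).
  assert (dph : forall t, is_derive ph t (2 * hsqrt2 * w t)).
  { intros t. rewrite <- (Rplus_0_l (2 * hsqrt2 * w t)).
    apply (is_derive_plus (fun _ => PI / 4 - 2 * theta 0) (fun t => RInt (fun t => 2 * hsqrt2 * w t) 0 t)).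
    apply @is_derive_const. now apply (is_derive_primitive (fun t => 2 * hsqrt2 * w t)). }
  assert (ph0 : half_angle (ph 0) = theta 0).
  { unfold ph. rewrite RInt_point. unfold half_angle, zero; simpl. field. }
  set (th := fun t => half_angle (ph t)).
  assert (dth : forall t, is_derive th t (- (hsqrt2 * w t))).
  { intros t. unfold th, half_angle. auto_derive. { exists (2 * hsqrt2 * w t). apply dph. }
    replace (Derive (fun x => ph x) t) with (2 * hsqrt2 * w t) by (symmetry; exact (is_derive_unique ph t _ (dph t))). field. }
  set (rr := fun t => sqrt (fst (fst (u t)) * fst (fst (u t)) + snd (fst (u t)) * snd (fst (u t)))).
  assert (Hrr : forall t, 0 < rr t) by (intros t; apply sqrt_lt_R0, HQ).
  assert (rot : forall t,
     is_derive (fun t => (fst (fst (u t)) * cos (th t) + snd (fst (u t)) * sin (th t)) / rr t) t 0 /\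
     is_derive (fun t => (snd (fst (u t)) * cos (th t) - fst (fst (u t)) * sin (th t)) / rr t) t 0).
  { intros t. destruct (comp t) as (D1 & D2 & _). specialize (dth t). specialize (HQ t). specialize (Hrr t).
    fold (w t) in D1, D2.
    set (dx := hsqrt2 * (l * growth_at l (u t) * fst (fst (u t)) + w t * snd (fst (u t)))) in *.
    set (dy := hsqrt2 * (l * growth_at l (u t) * snd (fst (u t)) - w t * fst (fst (u t)))) in *.
    pose (x1 := fun t => fst (fst (u t))). pose (x2 := fun t => snd (fst (u t))).
    assert (Ux : Derive (fun t => x1 t) t = dx) by exact (is_derive_unique x1 t _ D1).
    assert (Uy : Derive (fun t => x2 t) t = dy) by exact (is_derive_unique x2 t _ D2).
    assert (Uth : Derive (fun t => th t) t = - (hsqrt2 * w t)) by exact (is_derive_unique _ t _ dth).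
    assert (drr : is_derive rr t (hsqrt2 * (l * growth_at l (u t)) * rr t)).
    { apply (is_derive_ext (fun t => sqrt (x1 t * x1 t + x2 t * x2 t))); [reflexivity|].
      auto_derive. { repeat split; auto; try (exists dx; exact D1); try (exists dy; exact D2). }
      rewrite Ux, Uy. unfold x1, x2. fold (rr t).
      apply (Rmult_eq_reg_r (2 * rr t)); [|lra]. field_simplify; [|lra].
      transitivity (2 * hsqrt2 * l * growth_at l (u t) * (rr t * rr t)); [|ring].
      unfold rr. rewrite sqrt_sqrt by lra. unfold dx, dy. ring. }
    assert (Ur : Derive (fun t => rr t) t = hsqrt2 * (l * growth_at l (u t)) * rr t) by exact (is_derive_unique _ t _ drr).
    split; [ apply (is_derive_ext (fun t => (x1 t * cos (th t) + x2 t * sin (th t)) / rr t)); [reflexivity|]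
           | apply (is_derive_ext (fun t => (x2 t * cos (th t) - x1 t * sin (th t)) / rr t)); [reflexivity|] ];
    (auto_derive;
      [ repeat split; try (exists dx; exact D1); try (exists dy; exact D2); try (eexists; exact dth);
        try (eexists; exact drr); lra
      | rewrite Ux, Uy, Uth, Ur; unfold dx, dy, x1, x2; field; lra ]). }
  assert (rr0 : rr 0 = rho 0).
  { unfold rr. rewrite Hx0, Hy0.
    replace (_ + _) with (rho 0 * rho 0).
    - rewrite sqrt_square; lra.
    - assert (C := sin_sq (theta 0)). transitivity (rho 0 * rho 0 * (cos (theta 0) * cos (theta 0) + sin (theta 0) * sin (theta 0))).
      rewrite C. ring. ring. }
  assert (Hcs : forall t, fst (fst (u t)) = rr t * cos (th t) /\ snd (fst (u t)) = rr t * sin (th t)).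
  { intros t. assert (C := sin_sq (th t)).
    assert (A1 : (fst (fst (u t)) * cos (th t) + snd (fst (u t)) * sin (th t)) / rr t = 1).
    { rewrite (zero_derive_const _ (fun t => proj1 (rot t)) t 0). unfold th. rewrite ph0, rr0, Hx0, Hy0.
      assert (C0 := sin_sq (theta 0)).
      transitivity (cos (theta 0) * cos (theta 0) + sin (theta 0) * sin (theta 0)). field. lra. rewrite C0. ring. }
    assert (A2 : (snd (fst (u t)) * cos (th t) - fst (fst (u t)) * sin (th t)) / rr t = 0).
    { rewrite (zero_derive_const _ (fun t => proj2 (rot t)) t 0). unfold th. rewrite ph0, rr0, Hx0, Hy0.
      field. lra. }
    specialize (Hrr t).
    assert (B1 : fst (fst (u t)) * cos (th t) + snd (fst (u t)) * sin (th t) = rr t).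
    { apply (Rmult_eq_reg_r (/ rr t)). rewrite Rinv_r by lra. exact A1. apply Rinv_neq_0_compat; lra. }
    assert (B2 : snd (fst (u t)) * cos (th t) - fst (fst (u t)) * sin (th t) = 0).
    { apply (Rmult_eq_reg_r (/ rr t)). rewrite Rmult_0_l. exact A2. apply Rinv_neq_0_compat; lra. }
    split.
    - rewrite <- B1. transitivity (fst (fst (u t)) * (cos (th t) * cos (th t) + sin (th t) * sin (th t)) +
        sin (th t) * (snd (fst (u t)) * cos (th t) - fst (fst (u t)) * sin (th t))); [|ring].
      rewrite B2, C. ring.
    - rewrite <- B1. transitivity (snd (fst (u t)) * (cos (th t) * cos (th t) + sin (th t) * sin (th t)) -
        cos (th t) * (snd (fst (u t)) * cos (th t) - fst (fst (u t)) * sin (th t))); [|ring].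
      rewrite B2, C. ring. }
  assert (trig : forall t, cos_coord (u t) = cos (ph t) /\ sin_coord (u t) = sin (ph t)).
  { intros t. apply (aligned_unique (fst (fst (u t))) (snd (fst (u t)))); auto.
    - now apply coordinates_aligned.
    - destruct (Hcs t) as [-> ->]. apply point_aligned. }
  assert (upt : forall t, u t = point_of l (ph t) (slow_coord l (u t)) (fast_coord l (u t))).
  { intros t. rewrite (point_height l (u t) Hl0 (HE t)) at 1. unfold point_of.
    destruct (trig t) as [<- _].
    assert (Er : radius l (slow_coord l (u t)) = rr t).
    { unfold radius, rr. f_equal. unfold slow_coord, energy. transitivity (2 * (hsqrt2 * hsqrt2) * (fst (fst (u t)) * fst (fst (u t)) + snd (fst (u t)) * snd (fst (u t)))).
      field. auto. rewrite hsqrt2_sq. field. }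
    rewrite Er. destruct (Hcs t) as [Hc1 Hc2]. fold (th t). now rewrite <- Hc1, <- Hc2. }
  destruct (increasing_inverse ph (fun t => 2 * hsqrt2 * w t) (1/2) ltac:(lra) dph) as (g & pg & gp & dg).
  { intros t. specialize (Hw t). nra. }
  set (L := ph T - ph 0).
  assert (pw : forall t, w (t + T) = w t) by (intros t; unfold w; now rewrite pu).
  assert (pph : forall t, ph (t + T) = ph t + L).
  { intros t. assert (E : ph (t + T) - ph t = ph (0 + T) - ph 0).
    { apply (zero_derive_const (fun t => ph (t + T) - ph t)). intros s.
      replace 0 with (2 * hsqrt2 * w (s + T) - 2 * hsqrt2 * w s) by (rewrite pw; ring).
      apply (is_derive_minus (fun t => ph (t + T)) ph); auto. apply (is_derive_shift ph). apply dph. }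
    rewrite Rplus_0_l in E. unfold L. lra. }
  assert (HL : 0 < L).
  { unfold L. destruct (MVT_gen ph 0 T (fun t => 2 * hsqrt2 * w t)) as (z & _ & E).
    - intros; apply dph.
    - intros t _. apply continuity_pt_filterlim, (is_derive_continuous ph t _ (dph t)).
    - rewrite E. specialize (Hw z). assert (0 < 2 * hsqrt2 * w z) by nra. apply Rmult_lt_0_compat; lra. }
  assert (gL : forall s, g (s + L) = g s + T).
  { intros s. rewrite <- (pg s) at 1. rewrite <- pph. apply gp. }
  exists (fun s => slow_coord l (u (g s))), (fun s => fast_coord l (u (g s))), L.
  split; [|split; [|split; [|split; [|split; [exact HL|]]]]].
  - intros q. split.
    + intros Hq. apply Hg in Hq. destruct Hq as [t E]. exists (ph t). rewrite gp, E. apply upt.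
    + intros [s E]. apply Hg. exists (g s). rewrite E. rewrite (upt (g s)) at 3. now rewrite pg.
  - intros s. destruct (rates (g s)) as [D1 D2]. destruct (trig (g s)) as [E1 E2]. rewrite pg in E1, E2.
    assert (Hws := Hw (g s)). assert (Dg := dg s).
    assert (Ew : w (g s) = speed l (cos s) (sin s) (slow_coord l (u (g s))) (fast_coord l (u (g s)))).
    { unfold w, speed_at. now rewrite E1, E2. }
    unfold growth_at in D1. rewrite E1, E2 in D1, D2. rewrite Ew in Hws, Dg.
    split.
    + rewrite Rminus_0_r. unfold slow.
      set (y := speed l (cos s) (sin s) (slow_coord l (u (g s))) (fast_coord l (u (g s)))) in *.
      replace (l * _) with (scal (/ (2 * hsqrt2 * y)) (2 * hsqrt2 * (l * (slow_coord l (u (g s)) * growth l (cos s) (sin s))))).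
      * apply (is_derive_comp (fun t => slow_coord l (u t)) g); auto.
      * unfold scal; simpl; unfold mult; simpl. field. lra.
    + rewrite fast_rate_quotient by lra.
      set (y := speed l (cos s) (sin s) (slow_coord l (u (g s))) (fast_coord l (u (g s)))) in *.
      replace (_ / y) with (scal (/ (2 * hsqrt2 * y)) (2 * hsqrt2 * fast_rate l (cos s) (sin s) (slow_coord l (u (g s))) (fast_coord l (u (g s))))).
      * apply (is_derive_comp (fun t => fast_coord l (u t)) g); auto.
      * unfold scal; simpl; unfold mult; simpl. field. lra.
  - intros s. split; apply bx.
  - intros s. apply bx.
  - assert (pp : forall f : point -> R, periodic L (fun s => f (u (g s)))) by (intros f s; now rewrite gL, pu).
    repeat split.
    + apply pp.
    + apply pp.
    + intros s. destruct (trig (g (s + L))) as [E1 _]. destruct (trig (g s)) as [E2 _].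
      rewrite pg in E1, E2. rewrite <- E1, <- E2. apply (pp cos_coord).
    + intros s. destruct (trig (g (s + L))) as [_ E1]. destruct (trig (g s)) as [_ E2].
      rewrite pg in E1, E2. rewrite <- E1, <- E2. apply (pp sin_coord).
Qed.

(** * Limit cycles *)

Lemma continuous_xyz (q : point) :
  continuous (fun q : point => fst (fst q)) q /\ continuous (fun q : point => snd (fst q)) q /\
  continuous (fun q : point => snd q) q.
Proof.
  destruct q as [[x y] z]. split; [|split].
  - apply (continuous_comp (fun q : point => fst q) fst); [apply (continuous_fst (x, y) z) | apply continuous_fst].
  - apply (continuous_comp (fun q : point => fst q) snd); [apply (continuous_fst (x, y) z) | apply continuous_snd].
  - apply (continuous_snd (x, y) z).
Qed.

Lemma energy_continuous (q : point) : continuous energy q.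
Proof.
  destruct (continuous_xyz q) as (Cx & Cy & _). unfold energy.
  apply (continuous_mult (fun _ : point => hsqrt2 / 2)). apply continuous_const.
  apply (continuous_plus (fun q : point => fst (fst q) * fst (fst q)) (fun q : point => snd (fst q) * snd (fst q)));
  [apply (continuous_mult (fun q : point => fst (fst q))) | apply (continuous_mult (fun q : point => snd (fst q)))]; auto.
Qed.

Lemma excess_continuous (q : point) : continuous excess q.
Proof.
  destruct (continuous_xyz q) as (Cx & Cy & Cz). unfold excess, ecos.
  assert (M : forall f g : point -> R, continuous f q -> continuous g q -> continuous (fun q => f q * g q) q)
    by (intros f g; apply (continuous_mult f g)).
  assert (S : forall f g : point -> R, continuous f q -> continuous g q -> continuous (fun q => f q - g q) q)
    by (intros f g; apply (continuous_minus f g)).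
  assert (A : forall f g : point -> R, continuous f q -> continuous g q -> continuous (fun q => f q + g q) q)
    by (intros f g; apply (continuous_plus f g)).
  assert (K : forall a : R, continuous (fun _ : point => a) q) by (intros a; apply continuous_const).
  unfold Rdiv. auto 10.
Qed.

Lemma region_open l r : open (region l r).
Proof.
  unfold region.
  assert (O1 : forall (f : point -> R) a b, (forall q, continuous f q) -> open (fun q => a < f q < b)).
  { intros f a b Cf. apply (open_comp f (fun y => a < y < b)).
    - intros q _. apply Cf.
    - apply open_and. apply open_gt. apply open_lt. }
  apply open_and; apply O1. apply energy_continuous. apply excess_continuous.
Qed.

Lemma point_of_coordinates l t x v : 0 < l * x ->
  energy (point_of l t x v) = l * x /\ excess (point_of l t x v) = l ^ 2 * v.
Proof.
  intros H. assert (R := radius_sq l x H). assert (K := hsqrt2_sq). assert (C := sin_sq (half_angle t)).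
  destruct (point_aligned t (radius l x)) as [A1 A2].
  assert (E0 : energy (point_of l t x v) = l * x).
  { unfold energy, point_of; simpl.
    transitivity (hsqrt2 / 2 * (radius l x * radius l x) * (cos (half_angle t) * cos (half_angle t) + sin (half_angle t) * sin (half_angle t))). ring.
    rewrite R, C. transitivity (2 * (hsqrt2 * hsqrt2) * (l * x)). field. rewrite K. field. }
  split; [exact E0|].
  assert (Ec : ecos (point_of l t x v) = l * x * cos t).
  { rewrite <- E0. unfold ecos, energy, point_of; simpl.
    set (x1 := radius l x * cos (half_angle t)) in *. set (x2 := radius l x * sin (half_angle t)) in *.
    transitivity ((x1 * (x1 + x2) + x2 * (x1 - x2)) / 4). field.
    transitivity ((2 * (hsqrt2 * hsqrt2)) * (x1 * (x1 + x2) + x2 * (x1 - x2)) / 4). rewrite K; field.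
    transitivity (hsqrt2 / 2 * (x1 * (hsqrt2 * (x1 + x2)) + x2 * (hsqrt2 * (x1 - x2)))). field.
    rewrite <- A1, <- A2. ring. }
  unfold excess. rewrite Ec. unfold point_of, height; simpl.
  transitivity (2 * (hsqrt2 * hsqrt2) * (1 + l * x * cos t + l ^ 2 * v) - 1 - l * x * cos t). simpl; ring.
  rewrite K. simpl; field.
Qed.

(** The total angle of a closed orbit is a multiple of 2 pi. *)
Lemma cos_one_period L : cos L = 1 -> forall f, periodic (2 * PI) f -> periodic L f.
Proof.
  intros H f Hf t.
  assert (S : sin (L / 2) = 0).
  { replace L with (2 * (L / 2)) in H by field. rewrite cos_2a_sin in H. nra. }
  destruct (sin_eq_0_0 _ S) as [k Hk].
  replace (t + L) with (t + IZR k * (2 * PI)) by lra. now apply periodic_IZR.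
Qed.

Lemma limit_cycle_exists l r : uniformly_small (1/4000) l -> root r ->
  exists gamma, limit_cycle (params_at l) gamma /\ contained_in gamma (region l r) /\ exists q, gamma q.
Proof.
  intros Ht Hr. assert (Hl := proj1 Ht). assert (Hr' := root_range r Hr).
  destruct (profile_exists l r Ht Hr) as (X & V & HP & pX & pV & B & HX).
  assert (HC : contained_in (orbit l X V) (region l r)).
  { intros q [t ->]. destruct (HX t) as [H1 H2]. apply Rabs_le_between in H1. apply Rabs_le_between in H2.
    assert (Hx : 0 < l * X t) by (apply Rmult_lt_0_compat; lra).
    assert (Hl2 : 0 < l ^ 2) by (apply pow_lt; lra).
    unfold region. destruct (point_of_coordinates l t (X t) (V t) Hx) as [-> ->]. split; nra. }
  exists (orbit l X V). split; [|split].
  - split. { now apply profile_orbit. }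
    exists (region l r). split; [apply region_open | split; [exact HC|]].
    intros gamma' Hg HN.
    destruct (orbit_profile l r gamma' Ht Hr Hg HN) as (X' & V' & L & HS & HP' & B' & HX' & HL & pX' & pV' & pc & ps).
    assert (C1 : cos L = 1). { rewrite <- (Rplus_0_l L), pc. apply cos_0. }
    assert (U : forall t, X t = X' t /\ V t = V' t).
    { apply (profile_unique l r L); auto; try (now apply cos_one_period).
      intros t. destruct (HX t). lra. }
    intros q. split.
    + intros Hq. apply HS in Hq. destruct Hq as [t ->]. exists t. destruct (U t) as [-> ->]. reflexivity.
    + intros [t ->]. apply HS. exists t. destruct (U t) as [-> ->]. reflexivity.
  - exact HC.
  - exists (point_of l 0 (X 0) (V 0)). now exists 0.
Qed.

Lemma regions_disjoint l r r' q : 0 < l -> r + 1/2 <= r' -> region l r q -> ~ region l r' q.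
Proof. intros Hl Hr [H _] [H' _]. nra. Qed.

Lemma params_at_near (V : params -> Prop) : locally ((0, 0, 0, sqrt 2) : params) V -> at_right 0 (fun l => V (params_at l)).
Proof.
  intros HV.
  assert (C : continuous params_at 0).
  { apply (@ex_derive_continuous R_AbsRing (prod_NormedModule R_AbsRing (prod_NormedModule R_AbsRing
      (prod_NormedModule R_AbsRing R_NormedModule R_NormedModule) R_NormedModule) R_NormedModule) params_at 0).
    eexists. unfold params_at, par_a, par_b, par_c, par_shift. repeat apply is_derive_pair.
    1-3: auto_derive; [auto | reflexivity].
    apply @is_derive_const. }
  assert (E : params_at 0 = (0, 0, 0, sqrt 2)).
  { unfold params_at, par_a, par_b, par_c, par_shift. repeat f_equal; field. }
  rewrite <- E in HV.
  apply (filter_le_within (F := locally 0) (fun u => 0 < u)). exact (C V HV).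
Qed.

(** In the region x^2 + y^2 is at most 13 l and z differs from its value at the
    singular point by at most 27 l. *)
Lemma region_near (U : point -> Prop) : locally (sing_point (sqrt 2)) U ->
  at_right 0 (fun l => forall r, root r -> contained_in (region l r) U).
Proof.
  intros [eps HU]. assert (He := cond_pos eps).
  assert (P : 0 < Rmin 1 (Rmin (eps / 30) (eps * eps / 30))).
  { apply Rmin_pos. lra. apply Rmin_pos; nra. }
  generalize (small_lt _ P). apply filter_imp. intros l [Hl0 Hl] r Hr q [[E1 E2] [V1 V2]].
  assert (Hr' := root_range r Hr).
  assert (M1 := Rmin_l 1 (Rmin (eps / 30) (eps * eps / 30))).
  assert (M2 := Rmin_r 1 (Rmin (eps / 30) (eps * eps / 30))).
  assert (M3 := Rmin_l (eps / 30) (eps * eps / 30)). assert (M4 := Rmin_r (eps / 30) (eps * eps / 30)).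
  assert (Hh := hsqrt2_bounds). assert (K := hsqrt2_sq).
  assert (Z : sing_point (sqrt 2) = (0, 0, hsqrt2)).
  { unfold sing_point. f_equal. unfold hsqrt2. assert (S := sqrt_sqrt 2 ltac:(lra)). assert (S' := sqrt_lt_R0 2 ltac:(lra)).
    apply (Rmult_eq_reg_r (sqrt 2)). field_simplify; lra. lra. }
  apply HU. rewrite Z. destruct q as [[x y] z].
  unfold excess, ecos, energy in *; simpl fst in *; simpl snd in *.
  assert (Q : x * x + y * y <= 13 * l) by nra.
  assert (El : l * l <= l) by nra.
  assert (L2 : l ^ 2 <= l) by (simpl; lra).
  assert (W : forall w, w * w <= 13 * l -> Rabs w < eps).
  { intros w Hw. apply Rabs_def1; nra. }
  assert (Qx := Rle_0_sqr x). assert (Qy := Rle_0_sqr y). unfold Rsqr in Qx, Qy.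
  assert (Qp := Rle_0_sqr (x + y)). assert (Qm := Rle_0_sqr (x - y)). unfold Rsqr in Qp, Qm.
  split; [split|].
  - change (Rabs (x - 0) < eps). rewrite Rminus_0_r. apply W. lra.
  - change (Rabs (y - 0) < eps). rewrite Rminus_0_r. apply W. lra.
  - change (Rabs (z - hsqrt2) < eps).
    assert (D : - (27 * l) <= 2 * hsqrt2 * (z - hsqrt2) <= 27 * l).
    { replace (2 * hsqrt2 * (z - hsqrt2)) with (2 * hsqrt2 * z - 2 * (hsqrt2 * hsqrt2)) by ring. rewrite K. lra. }
    apply Rabs_def1; nra.
Qed.

Theorem theorem3 :
  exists d0 : R, d0 <> 0 /\
  forall (V : params -> Prop) (U : point -> Prop),
    locally ((0, 0, 0, d0) : params) V ->
    locally (sing_point d0) U ->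
    exists a b c d : R,
      V (a, b, c, d) /\ d <> 0 /\
      exists gamma1 gamma2 gamma3 : point -> Prop,
        (limit_cycle (a, b, c, d) gamma1 /\ contained_in gamma1 U) /\
        (limit_cycle (a, b, c, d) gamma2 /\ contained_in gamma2 U) /\
        (limit_cycle (a, b, c, d) gamma3 /\ contained_in gamma3 U) /\
        ~ same_set gamma1 gamma2 /\
        ~ same_set gamma1 gamma3 /\
        ~ same_set gamma2 gamma3.
Proof.
  assert (S2 : sqrt 2 <> 0) by (assert (S := sqrt_lt_R0 2 ltac:(lra)); lra).
  exists (sqrt 2). split; [exact S2|]. intros V U HV HU.
  assert (He : 0 < 1/4000) by lra.
  destruct (filter_ex _ (filter_and _ _ (uniformly_small_eventually (1/4000) He)
    (filter_and _ _ (params_at_near V HV) (region_near U HU)))) as (l & Ht & HVl & HUl).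
  assert (Hl := proj1 Ht).
  assert (rt1 : root 1) by (unfold root; auto). assert (rt2 : root 2) by (unfold root; auto).
  assert (rt3 : root 3) by (unfold root; auto).
  destruct (limit_cycle_exists l 1 Ht rt1) as (g1 & L1 & C1 & q1 & Q1).
  destruct (limit_cycle_exists l 2 Ht rt2) as (g2 & L2 & C2 & q2 & Q2).
  destruct (limit_cycle_exists l 3 Ht rt3) as (g3 & L3 & C3 & _).
  assert (inU : forall r g, root r -> contained_in g (region l r) -> contained_in g U).
  { intros r g Hr Hg q Hq. exact (HUl r Hr q (Hg q Hq)). }
  assert (distinct : forall r r' g g' q, r + 1/2 <= r' -> contained_in g (region l r) ->
    contained_in g' (region l r') -> g q -> ~ same_set g g').
  { intros r r' g g' q Hrr Hg Hg' Hq HS.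
    apply (regions_disjoint l r r' q (proj1 Hl) Hrr (Hg q Hq)). apply Hg', HS, Hq. }
  exists (par_a l), (par_b l), (par_c l), (sqrt 2). split; [exact HVl | split; [exact S2|]].
  exists g1, g2, g3.
  split; [split; [exact L1 | exact (inU 1 g1 rt1 C1)]|].
  split; [split; [exact L2 | exact (inU 2 g2 rt2 C2)]|].
  split; [split; [exact L3 | exact (inU 3 g3 rt3 C3)]|].
  split; [apply (distinct 1 2 g1 g2 q1); auto; lra|].
  split; [apply (distinct 1 3 g1 g3 q1); auto; lra | apply (distinct 2 3 g2 g3 q2); auto; lra].
Qed.
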